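(* For any $\lambda\in\{\lambda_i^j: 1\leq i\leq\mu_2,\ 0\leq j\leq N_i\}$, the classes of those $\widetilde{\omega}_i^j$ for which $\lambda_i^j=\lambda$ induce a basis of the vector space $\mathrm{gr}^V_\lambda(G_0/\tau^{-1}G_0)$. Hence the numbers $\lambda_i^j$ together with their multiplicities form the spectrum of $(\mathbf{G}_0,G_0)$.
   Context: Setting. Let $\mathcal{O}=\mathbb{C}[x_1,\dots,x_{n+1}]$, graded by giving $x_i$ a positive rational weight $p_i$; ''homogeneous'' always refers to this grading. Let $g=(g_1,\dots,g_n):\mathbb{C}^{n+1}\to\mathbb{C}^n$ be a polynomial map with $g_i$ homogeneous of degree $e_i$, and assume that $C_0=g^{-1}(0)$ is a reduced complete intersection curve which is not smooth. Let $f\in\mathcal{O}$ be homogeneous of degree $1$ and such that $f_0:=f|_{C_0}$ is not constant on any branch of $C_0$. Let $J$ be the Jacobian determinant of $(f,g_1,\dots,g_n)$, $I=(g_1,\dots,g_n)$, $\mu=\dim_{\mathbb{C}}\mathcal{O}/(I+(J))$. The coordinates $t_1,\dots,t_n$ on the target of $g$ act on $\mathcal{O}$ as multiplication by $g_1,\dots,g_n$. Gauss–Manin system. Let $\alpha=dx_1\wedge\dots\wedge dx_{n+1}/dg_1\wedge\dots\wedge dg_n$, let $\omega_g=\mathcal{O}\alpha$ be the relative dualising module of $g$ and $\omega_{C_0}=\omega_g/I\omega_g$. The relative differential $d:\mathcal{O}\to\omega_g$ is $dh=J_h\alpha$, with $J_h$ the Jacobian determinant of $(h,g_1,\dots,g_n)$;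 in particular $df=J\alpha$. Put $$\mathbf{G}:=\frac{\omega_g[\tau,\tau^{-1}]}{(d-\tau\, df\wedge)\mathcal{O}[\tau,\tau^{-1}]},\qquad (df\wedge)h=hJ\alpha,$$ with the operator $\partial_\tau$ determined by $\partial_\tau[\omega]=[-f\omega]$ for $\omega\in\omega_g$ and the Leibniz rule in $\tau$. Let $G$ be the image of $\omega_g[\tau^{-1}]\to\mathbf{G}$ (the Brieskorn lattice; it is free of rank $\mu$ over $\mathbb{C}[t_1,\dots,t_n,\tau^{-1}]$). Put $\mathbf{G}_0=\mathbf{G}/(t_1,\dots,t_n)\mathbf{G}$ and $G_0=G/(t_1,\dots,t_n)G$. $V$-filtration and spectrum. The Malgrange–Kashiwara filtration $V_\bullet(\mathbf{G}_0)$ is the unique increasing exhaustive filtration indexed by $\mathbb{Q}$ such that: (1) each $V_\lambda$ is $\mathbb{C}[\tau]$-free and $\mathbb{C}[\tau,\tau^{-1}]\otimes_{\mathbb{C}[\tau]}V_\lambda=\mathbf{G}_0$; (2) $\tau V_\lambda=V_{\lambda-1}$ and $\partial_\tau V_\lambda\subset V_{\lambda+1}$; (3) $\tau\partial_\tau+\lambda$ is nilpotent on $\mathrm{gr}^V_\lambda=V_\lambda/V_{<\lambda}$; (4) there is a finite set $A\subset[0,1)$ such that $V_\lambda=V_{\lambda'}$ where $\lambda'$ is the largest element of $A+\mathbb{Z}$ with $\lambda'\le\lambda$ (so $\mathrm{gr}^V_\lambda=0$ for $\lambda\notin A+\mathbb{Z}$). Define $$\mathrm{gr}^V_\lambda(G_0/\tau^{-1}G_0):=\frac{V_\lambda\cap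 G_0}{V_\lambda\cap\tau^{-1}G_0+V_{<\lambda}\cap G_0},\qquad d(\lambda)=\dim_{\mathbb{C}}\mathrm{gr}^V_\lambda(G_0/\tau^{-1}G_0).$$ The spectrum of $(\mathbf{G}_0,G_0)$ is the set of pairs $(\lambda,d(\lambda))$ with $d(\lambda)\neq0$. Basis. Let $\mu_2=\dim_{\mathbb{C}}\mathcal{O}/((f)+I)-1$. Multiplication by $-f_0$ on $\omega_{C_0}/\mathcal{O}_{C_0}df_0\cong\mathcal{O}/(I+(J))$ is nilpotent and homogeneous with $\mu_2$-dimensional kernel. Fix a homogeneous Jordan basis: homogeneous $\omega_1^0,\dots,\omega_{\mu_2}^0\in\omega_g$ and integers $N_i\geq0$ such that, with $\omega_i^j:=(-f)^j\omega_i^0$, the classes of $\omega_i^j$ $(1\le i\le\mu_2,\ 0\le j\le N_i)$ form a basis of $\omega_{C_0}/\mathcal{O}_{C_0}df_0$, and $f\omega_i^{N_i}$ has zero class. Put $\mathbf{e}=\sum e_i$, $\mathbf{p}=\sum p_i$; for $\omega=h\alpha$ with $h$ homogeneous let $\nu(\omega)=\deg h+\mathbf{p}-\mathbf{e}$, and $\nu_i^j:=\nu(\omega_i^j)$. One has $\nu_i^0\le1$. Define $$\widetilde{\omega}_i^j=\begin{cases}[\omega_i^j]+(\nu_i^j-1)\tau^{-1}[\omega_i^{j-1}] & \text{if }\nu_i^j>1,\\ [\omega_i^j] & \text{if }\nu_i^j\leq1,\end{cases}\qquad \lambda_i^j=\begin{cases}1&\text{if }\nu_i^j>1,\\ \nu_i^j&\text{if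 }0\leq\nu_i^j\leq1,\\ 0&\text{if }\nu_i^j<0.\end{cases}$$ *)

(* Defs.v *)
From HB Require Import structures.
From mathcomp Require Import all_boot all_order all_algebra.
From mathcomp Require Import generic_quotient ring_quotient.
From mathcomp Require Import complex.
From mathcomp Require Import boolp classical_sets reals.
From mathcomp Require Import finmap monalg mpoly.

Set Implicit Arguments.
Unset Strict Implicit.
Unset Printing Implicit Defensive.

Import Order.TTheory GRing.Theory Num.Theory.

Local Open Scope classical_set_scope.
Local Open Scope ring_scope.
Local Open Scope quotient_scope.

Definition subspace (K : pzRingType) (U : lmodType K) (S : set U) : Prop :=
  S 0 /\ forall (a : K) x y, S x -> S y -> S (a *: x + y).

Section QuotientModule.
Variables (K : pzRingType) (U : lmodType K) (S : set U) (S_sub : subspace S).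

Definition in_sub of subspace S : {pred U} := fun x => `[< S x >].

Fact in_sub_submod : submod_closed (in_sub S_sub).
Proof.
split; first exact/asboolP/S_sub.1.
by move=> a x y /asboolP Sx /asboolP Sy; apply/asboolP/S_sub.2.
Qed.
HB.instance Definition _ :=
  GRing.isZmodClosed.Build U (in_sub S_sub) (GRing.submod_closedB in_sub_submod).

Definition quotmod : Type := Quotient.quot (in_sub S_sub).
HB.instance Definition _ := EqQuotient.on quotmod.
HB.instance Definition _ := Choice.on quotmod.
HB.instance Definition _ := GRing.Zmodule.on quotmod.

Local Notation Q := quotmod.

Lemma pi_quotB x y : \pi_Q (x - y) = \pi_Q x - \pi_Q y.
Proof. exact: raddfB. Qed.
Lemma pi_quotD x y : \pi_Q (x + y) = \pi_Q x + \pi_Q y.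
Proof. exact: raddfD. Qed.

Lemma pi_quotP x y : \pi_Q x = \pi_Q y <-> S (x - y).
Proof.
split=> [e|Sxy]; first by apply/asboolP; have /eqP := e; rewrite -Quotient.idealrBE.
by apply/eqP; rewrite -Quotient.idealrBE; apply/asboolP.
Qed.

Definition quot_scale (a : K) : Q -> Q :=
  lift_op1 Q ( *:%R a).

Lemma pi_quot_scale a x : quot_scale a (\pi_Q x) = \pi_Q (a *: x).
Proof.
rewrite /quot_scale; unlock; apply/pi_quotP; rewrite -scalerBr -[X in S X]addr0.
by apply: (S_sub.2 a _ _ _ S_sub.1); apply/pi_quotP; rewrite reprK.
Qed.

Fact quot_scaleA a b x : quot_scale a (quot_scale b x) = quot_scale (a * b) x.
Proof. by rewrite -[x]reprK !pi_quot_scale scalerA. Qed.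
Fact quot_scale1 : left_id 1 quot_scale.
Proof. by move=> x; rewrite -[x]reprK !pi_quot_scale scale1r. Qed.
Fact quot_scaleDr : right_distributive quot_scale +%R.
Proof.
move=> a x y; rewrite -[x]reprK -[y]reprK !pi_quot_scale -!pi_quotD.
by rewrite !pi_quot_scale scalerDr pi_quotD.
Qed.
Fact quot_scaleDl x : {morph quot_scale^~ x : a b / a + b}.
Proof. by move=> a b; rewrite -[x]reprK !pi_quot_scale scalerDl pi_quotD. Qed.

HB.instance Definition _ := GRing.Zmodule_isLmodule.Build K Q
  quot_scaleA quot_scale1 quot_scaleDr quot_scaleDl.

Lemma pi_quotZ a x : \pi_Q (a *: x) = a *: \pi_Q x.
Proof. by rewrite -pi_quot_scale. Qed.

Definition quotmap (phi : U -> U) : Q -> Q := lift_op1 Q phi.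

Lemma pi_quotmap (phi : U -> U) x : {morph phi : x y / x - y} ->
  (forall y, S y -> S (phi y)) -> quotmap phi (\pi_Q x) = \pi_Q (phi x).
Proof.
move=> phiB phiS; rewrite /quotmap; unlock; apply/pi_quotP; rewrite -phiB.
by apply/phiS/pi_quotP; rewrite reprK.
Qed.

End QuotientModule.

Section Laurent.
Variables (K : fieldType) (n : nat).
Local Notation O := {mpoly K[n.+1]}.

Definition laurent := {malg O[int]}.
HB.instance Definition _ := GRing.Zmodule.on laurent.

Definition laurent_scale (a : K) (x : laurent) : laurent :=
  a%:MP_[n.+1] *: (x : {malg O[int]}).
Fact laurent_scaleA a b x :
  laurent_scale a (laurent_scale b x) = laurent_scale (a * b) x.
Proof. by rewrite /laurent_scale scalerA mpolyCM. Qed.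
Fact laurent_scale1 : left_id 1 laurent_scale.
Proof. by move=> x; rewrite /laurent_scale scale1r. Qed.
Fact laurent_scaleDr : right_distributive laurent_scale +%R.
Proof. by move=> a x y; rewrite /laurent_scale scalerDr. Qed.
Fact laurent_scaleDl x : {morph laurent_scale^~ x : a b / a + b}.
Proof. by move=> a b; rewrite /laurent_scale mpolyCD scalerDl. Qed.
HB.instance Definition _ := GRing.Zmodule_isLmodule.Build K laurent
  laurent_scaleA laurent_scale1 laurent_scaleDr laurent_scaleDl.

Definition lmono (k : int) (h : O) : laurent := << h *g k >>.
Definition lcoef (x : laurent) (k : int) : O := monalg.mcoeff k x.
Definition lsupp (x : laurent) : {fset int} := monalg.msupp x.

(* The extension to O[tau, tau^-1] of the maps phi k : h tau^k |-> phi k h. *)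
Definition lsum (phi : int -> O -> laurent) (x : laurent) : laurent :=
  \sum_(k <- lsupp x) phi k (lcoef x k).

Lemma lcoefP x y : (forall k, lcoef x k = lcoef y k) -> x = y.
Proof. by move/malgP. Qed.
Lemma lcoefD x y k : lcoef (x + y) k = lcoef x k + lcoef y k.
Proof. exact: (raddfD (monalg.mcoeff k)). Qed.
Lemma lcoefZ a x k : lcoef (a *: x) k = a *: lcoef x k.
Proof. by rewrite -mul_mpolyC; apply: monalg.mcoeffZ. Qed.
Lemma lcoef_lmono k h l : lcoef (lmono k h) l = h *+ (k == l).
Proof. exact: monalg.mcoeffU. Qed.

Fact lmono_is_linear k : linear (lmono k).
Proof.
move=> a x y; apply: lcoefP => l.
by rewrite lcoefD lcoefZ !lcoef_lmono mulrnDl scalerMnr.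
Qed.
HB.instance Definition _ k := GRing.isLinear.Build K O laurent _ (lmono k)
  (lmono_is_linear k).

Lemma lsumE phi (d : {fset int}) x : (forall k, phi k 0 = 0) ->
  (lsupp x `<=` d)%fset -> lsum phi x = \sum_(k <- d) phi k (lcoef x k).
Proof.
move=> phi0 xd; rewrite /lsum (big_fset_incl _ xd) // => k _.
by move=> kx; rewrite /lcoef mcoeff_outdom.
Qed.

Lemma lsum_linear phi : (forall k, linear (phi k)) -> linear (lsum phi).
Proof.
move=> lin a x y.
have phi0 k : phi k 0 = 0.
  by have := lin k (-1) 0 0; rewrite scaler0 addr0 scaleN1r addNr.
pose d := (lsupp x `|` lsupp y `|` lsupp (a *: x + y)%R)%fset.
have dxy : (lsupp x `|` lsupp y `<=` d)%fset by rewrite fsubsetUl.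
have /andP[dx dy] : (lsupp x `<=` d)%fset && (lsupp y `<=` d)%fset.
  by rewrite -fsubUset.
rewrite !(@lsumE phi d) //; last by rewrite fsubsetUr.
rewrite scaler_sumr -big_split; apply: eq_bigr => k _ /=.
by rewrite lcoefD lcoefZ lin.
Qed.

Lemma lsum_lmono phi k h : phi k 0 = 0 -> lsum phi (lmono k h) = phi k h.
Proof.
move=> phi0; rewrite /lsum /lsupp monalg.msuppU; case: eqVneq => [->|_].
  by rewrite big_seq_fset0 phi0.
by rewrite big_seq_fset1 /lcoef monalg.mcoeffUU.
Qed.

Lemma lmonoE x : x = \sum_(k <- lsupp x) lmono k (lcoef x k).
Proof. exact: monalgE. Qed.

End Laurent.

Section GaussManin.
Variables (K : fieldType) (n : nat).
Local Notation O := {mpoly K[n.+1]}.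
Local Notation L := (laurent K n).
Implicit Types (f h : O) (g : 'I_n -> O) (x y : L).

Definition jac g h : O :=
  \det (\matrix_(i < n.+1, j < n.+1) (oapp g h (unlift ord0 i))^`M(j)).

(* omega_g = O alpha is identified with O through h alpha <-> h, so that the
   relative differential is h |-> jac g h. *)
Definition twisted_d f g : L -> L :=
  lsum (fun k h => lmono k (jac g h) - lmono (k + 1) (h * jac g f)).

Definition ltau (j : int) : L -> L := lsum (fun k h => lmono (k + j) h).
Definition lmul (q : O) : L -> L := lsum (fun k h => lmono k (q * h)).
(* partial_tau (omega tau^k) = k omega tau^(k-1) - f omega tau^k *)
Definition ldtau f : L -> L :=
  lsum (fun k h => lmono (k - 1) (h *~ k) - lmono k (f * h)).


Lemma jac_linear g : linear (jac g).
Proof.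
move=> a p q; rewrite -mul_mpolyC.
rewrite /jac (determinant_multilinear (i0 := ord0) (b := a%:MP) (c := 1)
  (B := \matrix_(i, j) (oapp g p (unlift ord0 i))^`M(j))
  (C := \matrix_(i, j) (oapp g q (unlift ord0 i))^`M(j))) ?mul1r //.
- by rewrite mul_mpolyC.
- apply/rowP=> j.
  by rewrite !mxE unlift_none /= mderivD mderiv_mulC mul1r.
- by apply/matrixP=> i j; rewrite !mxE liftK.
- by apply/matrixP=> i j; rewrite !mxE liftK.
Qed.

Lemma jacM g p q : jac g (p * q) = p * jac g q + q * jac g p.
Proof.
rewrite /jac (determinant_multilinear (i0 := ord0) (b := p) (c := q)
  (B := \matrix_(i, j) (oapp g q (unlift ord0 i))^`M(j))
  (C := \matrix_(i, j) (oapp g p (unlift ord0 i))^`M(j))) //.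
- by apply/rowP=> j; rewrite !mxE unlift_none /= mderivM addrC [q * _]mulrC.
- by apply/matrixP=> i j; rewrite !mxE liftK.
- by apply/matrixP=> i j; rewrite !mxE liftK.
Qed.

Lemma jac_base g i : jac g (g i) = 0.
Proof.
apply: (determinant_alternate (neq_lift ord0 i)) => j.
by rewrite !mxE unlift_none liftK.
Qed.

HB.instance Definition _ g := GRing.isLinear.Build K O O _ (jac g) (jac_linear g).

Fact twisted_d_linear f g : linear (twisted_d f g).
Proof.
apply: lsum_linear => k a p q.
by rewrite !linearP mulrDl -scalerAl linearP scalerBr opprD addrACA.
Qed.
Fact ltau_linear j : linear (ltau j).
Proof. by apply: lsum_linear => k a p q; rewrite linearP. Qed.
Fact lmul_linear q : linear (lmul q).
Proof. by apply: lsum_linear => k a p r; rewrite mulrDr -scalerAr linearP. Qed.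
Fact ldtau_linear f : linear (ldtau f).
Proof.
apply: lsum_linear => k a p q.
by rewrite mulrzDl scalerMzr mulrDr -scalerAr !linearP /= scalerBr scalerN addrACA.
Qed.
HB.instance Definition _ f g := GRing.isLinear.Build K L L _ (twisted_d f g)
  (twisted_d_linear f g).
HB.instance Definition _ j := GRing.isLinear.Build K L L _ (ltau j)
  (ltau_linear j).
HB.instance Definition _ q := GRing.isLinear.Build K L L _ (lmul q)
  (lmul_linear q).
HB.instance Definition _ f := GRing.isLinear.Build K L L _ (ldtau f)
  (ldtau_linear f).

Lemma twisted_d_lmono f g k h :
  twisted_d f g (lmono k h) = lmono k (jac g h) - lmono (k + 1) (h * jac g f).
Proof. by rewrite /twisted_d lsum_lmono // mul0r !linear0 addr0. Qed.
Lemma ltau_lmono j k h : ltau j (lmono k h) = lmono (k + j) h.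
Proof. by rewrite /ltau lsum_lmono // linear0. Qed.
Lemma lmul_lmono q k h : lmul q (lmono k h) = lmono k (q * h).
Proof. by rewrite /lmul lsum_lmono // mulr0 linear0. Qed.
Lemma ldtau_lmono f k h :
  ldtau f (lmono k h) = lmono (k - 1) (h *~ k) - lmono k (f * h).
Proof. by rewrite /ldtau lsum_lmono // mul0rz mulr0 !linear0 addr0. Qed.

Lemma laurent_ind (phi psi : {linear L -> L}) :
  (forall k h, phi (lmono k h) = psi (lmono k h)) -> phi =1 psi.
Proof.
by move=> e x; rewrite [x]lmonoE !linear_sum; apply: eq_bigr => k _; apply: e.
Qed.

Lemma twisted_d_tau f g j x :
  ltau j (twisted_d f g x) = twisted_d f g (ltau j x).
Proof.
apply: (laurent_ind (phi := ltau j \o twisted_d f g)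
  (psi := twisted_d f g \o ltau j)) => k h /=.
by rewrite ltau_lmono !twisted_d_lmono linearB /= !ltau_lmono addrAC.
Qed.

Lemma twisted_d_t f g i x :
  lmul (g i) (twisted_d f g x) = twisted_d f g (lmul (g i) x).
Proof.
apply: (laurent_ind (phi := lmul (g i) \o twisted_d f g)
  (psi := twisted_d f g \o lmul (g i))) => k h /=.
rewrite lmul_lmono !twisted_d_lmono linearB /= !lmul_lmono.
by rewrite jacM jac_base mulr0 addr0 mulrA.
Qed.

Lemma twisted_d_dtau f g x :
  ldtau f (twisted_d f g x) = twisted_d f g (ldtau f x).
Proof.
apply: (laurent_ind (phi := ldtau f \o twisted_d f g)
  (psi := twisted_d f g \o ldtau f)) => k h /=.
have e1 : k + 1 - 1 = k := addrK 1 k.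
have e2 : k - 1 + 1 = k := subrK 1 k.
have aux (V : zmodType) (A B C D E : V) : A - B - (C + D - E) = A - C - (B + D - E).
  by rewrite -!addrA; congr (_ + _); rewrite !opprD !opprK !addrA [- B - C]addrC.
rewrite ldtau_lmono twisted_d_lmono [LHS]raddfB [RHS]raddfB /=.
rewrite 2!ldtau_lmono 2!twisted_d_lmono e1 e2 jacM.
rewrite (mulrzDr _ k 1) mulr1z [jac g (h *~ k)]raddfMz [h *~ k * _]mulrzAl.
rewrite (raddfD (lmono k) (h * jac g f *~ k)) (raddfD (lmono k) (f * jac g h)).
by rewrite mulrA; apply: aux.
Qed.

Definition gm_rel f g : set L := range (twisted_d f g).

Fact gm_rel_subspace f g : subspace (gm_rel f g).
Proof.
split; first by exists 0 => //; rewrite linear0.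
by move=> a _ _ [x _ <-] [y _ <-]; exists (a *: x + y) => //; rewrite linearP.
Qed.

(* The Gauss-Manin system: the quotient of omega_g[tau, tau^-1]. *)
Local Notation GM f g := (quotmod (gm_rel_subspace f g)).

Definition gm_tau f g (j : int) : GM f g -> GM f g := quotmap (ltau j).
Definition gm_t f g (i : 'I_n) : GM f g -> GM f g := quotmap (lmul (g i)).
Definition gm_dtau f g : GM f g -> GM f g := quotmap (ldtau f).

Lemma gm_tauE f g j x : gm_tau j (\pi_(GM f g) x) = \pi_(GM f g) (ltau j x).
Proof.
apply: pi_quotmap => [y z|_ [y _ <-]]; first exact: raddfB.
by rewrite twisted_d_tau; exists (ltau j y).
Qed.
Lemma gm_tE f g i x : gm_t i (\pi_(GM f g) x) = \pi_(GM f g) (lmul (g i) x).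
Proof.
apply: pi_quotmap => [y z|_ [y _ <-]]; first exact: raddfB.
by rewrite twisted_d_t; exists (lmul (g i) y).
Qed.
Lemma gm_dtauE f g x : gm_dtau (\pi_(GM f g) x) = \pi_(GM f g) (ldtau f x).
Proof.
apply: pi_quotmap => [y z|_ [y _ <-]]; first exact: raddfB.
by rewrite twisted_d_dtau; exists (ldtau f y).
Qed.

Fact gm_tau_linear f g j : linear (@gm_tau f g j).
Proof.
move=> a x y; rewrite -[x]reprK -[y]reprK -pi_quotZ -pi_quotD !gm_tauE.
by rewrite linearP pi_quotD pi_quotZ.
Qed.
Fact gm_t_linear f g i : linear (@gm_t f g i).
Proof.
move=> a x y; rewrite -[x]reprK -[y]reprK -pi_quotZ -pi_quotD !gm_tE.
by rewrite linearP pi_quotD pi_quotZ.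
Qed.
Fact gm_dtau_linear f g : linear (@gm_dtau f g).
Proof.
move=> a x y; rewrite -[x]reprK -[y]reprK -pi_quotZ -pi_quotD !gm_dtauE.
by rewrite linearP pi_quotD pi_quotZ.
Qed.
HB.instance Definition _ f g j := GRing.isLinear.Build K (GM f g) (GM f g) _
  (@gm_tau f g j) (@gm_tau_linear f g j).
HB.instance Definition _ f g i := GRing.isLinear.Build K (GM f g) (GM f g) _
  (@gm_t f g i) (@gm_t_linear f g i).
HB.instance Definition _ f g := GRing.isLinear.Build K (GM f g) (GM f g) _
  (@gm_dtau f g) (@gm_dtau_linear f g).

Lemma gm_tau_t f g j i (y : GM f g) : gm_tau j (gm_t i y) = gm_t i (gm_tau j y).
Proof.
rewrite -[y]reprK gm_tauE !gm_tE gm_tauE; congr (\pi_(GM f g) _).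
apply: (laurent_ind (phi := ltau j \o lmul (g i))
  (psi := lmul (g i) \o ltau j)) => k h /=.
by rewrite lmul_lmono !ltau_lmono lmul_lmono.
Qed.

Lemma gm_dtau_t f g i (y : GM f g) : gm_dtau (gm_t i y) = gm_t i (gm_dtau y).
Proof.
rewrite -[y]reprK gm_dtauE !gm_tE gm_dtauE; congr (\pi_(GM f g) _).
apply: (laurent_ind (phi := ldtau f \o lmul (g i))
  (psi := lmul (g i) \o ldtau f)) => k h /=.
rewrite lmul_lmono !ldtau_lmono [RHS]raddfB /= 2!lmul_lmono.
by rewrite mulrzAr mulrCA.
Qed.

Definition gm_tsub f g : set (GM f g) :=
  [set y : GM f g | exists z : 'I_n -> GM f g, y = \sum_i gm_t i (z i)].

Fact gm_tsub_subspace f g : subspace (@gm_tsub f g).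
Proof.
split; first by exists (fun=> 0); rewrite big1 // => i _; rewrite linear0.
move=> a _ _ [z ->] [w ->]; exists (fun i => a *: z i + w i).
by rewrite scaler_sumr -big_split; apply: eq_bigr => i _; rewrite linearP.
Qed.

Local Notation GM0 f g := (quotmod (@gm_tsub_subspace f g)).

Definition gm0_tau f g (j : int) : GM0 f g -> GM0 f g := quotmap (gm_tau j).
Definition gm0_dtau f g : GM0 f g -> GM0 f g := quotmap (@gm_dtau f g).

Lemma gm0_tauE f g j (y : GM f g) :
  gm0_tau j (\pi_(GM0 f g) y) = \pi_(GM0 f g) (gm_tau j y).
Proof.
apply: pi_quotmap => [u v|_ [z ->]]; first exact: raddfB.
exists (fun i => gm_tau j (z i)); rewrite linear_sum.
by apply: eq_bigr => i _; apply: gm_tau_t.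
Qed.
Lemma gm0_dtauE f g (y : GM f g) :
  gm0_dtau (\pi_(GM0 f g) y) = \pi_(GM0 f g) (gm_dtau y).
Proof.
apply: pi_quotmap => [u v|_ [z ->]]; first exact: raddfB.
exists (fun i => gm_dtau (z i)); rewrite linear_sum.
by apply: eq_bigr => i _; apply: gm_dtau_t.
Qed.

Definition lattice f g : set (GM f g) :=
  [set y : GM f g | exists2 x : L,
    forall k, 0 < k -> lcoef x k = 0 & y = \pi_(GM f g) x].

(* G_0 = G/(t)G, viewed inside GM/(t)GM as when it is intersected with V_l;
   G/(t)G embeds there because G is free over K[t, tau^-1]. *)
Definition lattice0 f g : set (GM0 f g) := \pi_(GM0 f g) @` @lattice f g.

Definition gm0_class f g h : GM0 f g := \pi_(GM0 f g) (\pi_(GM f g) (lmono 0 h)).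

End GaussManin.

Arguments gm_tau {K n} f g j _.
Arguments gm_t {K n} f g i _.
Arguments gm_dtau {K n} f g _.
Arguments gm_tsub {K n} f g _.
Arguments gm0_tau {K n} f g j _.
Arguments gm0_dtau {K n} f g _.
Arguments lattice {K n} f g _.
Arguments lattice0 {K n} f g _.
Arguments gm0_class {K n} f g h.

Notation GaussManin f g := (quotmod (gm_rel_subspace f g)).
Notation GaussManin0 f g := (quotmod (gm_tsub_subspace f g)).

Section Filtration.
Variables (K : fieldType) (U : lmodType K).
Implicit Types (A B G : set U) (tau dtau : U -> U) (V : rat -> set U).

Definition subquot_basis A B (I : finType) (v : I -> U) : Prop :=
  [/\ forall i, A (v i),
      forall x, A x -> exists c : I -> K, B (x - \sum_i c i *: v i)
    & forall c : I -> K, B (\sum_i c i *: v i) -> forall i, c i = 0].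

Definition subquot_dim A B (d : nat) : Prop :=
  exists v : 'I_d -> U, subquot_basis A B v.

Definition poly_act tau (q : {poly K}) (x : U) : U :=
  \sum_(k < size q) q`_k *: iter k tau x.

(* A is a free K[tau]-module. *)
Definition tau_free tau A : Prop :=
  exists B, [/\ B `<=` A,
    forall x, A x -> exists (s : seq U) (c : U -> {poly K}),
      [set` s] `<=` B /\ x = \sum_(b <- s) poly_act tau (c b) b
  & forall (s : seq U) (c : U -> {poly K}), uniq s -> [set` s] `<=` B ->
      \sum_(b <- s) poly_act tau (c b) b = 0 -> {in s, forall b, c b = 0}].

Definition Vlt V (l : rat) : set U := \bigcup_(m in [set m | m < l]) V m.

Definition floor_in (A : seq rat) (l l' : rat) : Prop :=
  let AZ := [set a + z%:~R | a in [set` A] & z in [set: int]] in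
  [/\ AZ l', l' <= l & forall m, AZ m -> m <= l -> m <= l'].

Record MK_filtration tau dtau V : Prop := {
  MK_increasing : forall l m, l <= m -> V l `<=` V m;
  MK_exhaustive : forall x, exists l, V l x;
  MK_subspace : forall l, subspace (V l);
  MK_tau_stable : forall l x, V l x -> V l (tau x);
  MK_free : forall l, tau_free tau (V l);
  (* K[tau,tau^-1] (x) V l = U; as V l is a submodule of U, on which tau is
     invertible, its localization at tau is the set of the x below. *)
  MK_localization : forall l x, exists k, V l (iter k tau x);
  MK_tau : forall l, tau @` V l = V (l - 1);
  MK_dtau : forall l, dtau @` V l `<=` V (l + 1);
  MK_nilpotent : forall l, exists k, forall x, V l x ->
    Vlt V l (iter k (fun y => tau (dtau y) + ratr l *: y) x);
  MK_discrete : exists A : seq rat, {in A, forall a, 0 <= a < 1} /\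
    forall l, exists2 l', floor_in A l l' & V l = V l'
}.

(* gr^V_l (G / tau^-1 G) is the quotient of gr_num by gr_den. *)
Definition gr_num V G (l : rat) : set U := V l `&` G.
Definition gr_den tauV V G (l : rat) : set U :=
  [set x + y | x in V l `&` (tauV @` G) & y in Vlt V l `&` G].

Definition spectrum tauV V G : set (rat * nat) :=
  [set ld | ld.2 <> 0%N /\
            subquot_dim (gr_num V G ld.1) (gr_den tauV V G ld.1) ld.2].

End Filtration.

Section Geometry.
Variables (K : fieldType) (n : nat).
Local Notation O := {mpoly K[n.+1]}.
Implicit Types (f h q : O) (g : 'I_n -> O) (I : set O) (p : 'I_n.+1 -> rat).

Definition weight p (m : 'X_{1..n.+1}) : rat := \sum_i p i *+ m i.

Definition whomog p (d : rat) q : Prop :=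
  forall m, m \in msupp q -> weight p m = d.

(* For a nonzero homogeneous q, the degree of q. *)
Definition wdeg p q : rat := weight p (mlead q).

Definition base_ideal g : set O :=
  [set q | exists c : 'I_n -> O, q = \sum_i c i * g i].

Definition ideal_add h I : set O := [set q | exists c, I (q - c * h)].

Definition radical_ideal I : Prop := forall q k, I (q ^+ k) -> I q.

Definition prime_chain I (d : nat) : Prop :=
  exists P : 'I_d.+1 -> prime_idealr O, (forall k, I `<=` [set` P k]) /\
    (forall k l : 'I_d.+1, (k < l)%N -> [set` P k] `<` [set` P l]).

(* dim O/I = d *)
Definition krull_dim I (d : nat) : Prop :=
  prime_chain I d /\ ~ prime_chain I d.+1.

Definition minimal_prime I (P : prime_idealr O) : Prop :=
  I `<=` [set` P] /\
  forall Q : prime_idealr O, I `<=` [set` Q] -> [set` Q] `<=` [set` P] ->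
    [set` P] `<=` [set` Q].

(* Smoothness of g^-1(0) for K algebraically closed, when it is a curve. *)
Definition smooth_fiber g : Prop :=
  forall x : 'I_n.+1 -> K, (forall i, (g i).@[x] = 0) ->
    \rank (\matrix_(i < n, j < n.+1) ((g i)^`M(j)).@[x]) = n.

(* The branches of the quasihomogeneous curve g^-1(0) are its irreducible
   components Spec O/P. *)
Definition nonconstant_on_branches f g : Prop :=
  forall P : prime_idealr O, minimal_prime (base_ideal g) P ->
    forall c : K, f - c%:MP \notin P.

Definition omega f (h : O) (j : nat) : O := (- f) ^+ j * h.

Definition nu p (e : 'I_n -> rat) q : rat :=
  wdeg p q + \sum_i p i - \sum_i e i.

Definition lambda (a : rat) : rat := if 1 < a then 1 else if 0 <= a then a else 0.

Record Jordan_basis p f g (mu2 : nat) (h : 'I_mu2 -> O) (N : 'I_mu2 -> nat) :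
    Prop := {
  Jordan_mu2 : subquot_dim [set: O] (ideal_add f (base_ideal g)) (mu2 + 1);
  Jordan_homog : forall i, exists d, whomog p d (h i);
  (* omega_{C_0} / O_{C_0} df_0 is O / (I + (J)) *)
  Jordan_basis_of : subquot_basis [set: O]
    (ideal_add (jac g f) (base_ideal g))
    (fun ij : {i : 'I_mu2 & 'I_(N i).+1} => omega f (h (tag ij)) (tagged ij));
  Jordan_end : forall i,
    ideal_add (jac g f) (base_ideal g) (f * omega f (h i) (N i))
}.

(* As nu (h i) <= 1 for a Jordan basis, the first case has 0 < j. *)
Definition omega_tilde p (e : 'I_n -> rat) f g h (j : nat) : GaussManin0 f g :=
  let a := nu p e (omega f h j) in
  if 1 < a then gm0_class f g (omega f h j) +
    ratr (a - 1) *: gm0_tau f g (-1) (gm0_class f g (omega f h j.-1))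
  else gm0_class f g (omega f h j).

End Geometry.

(* Main.v *)
Require Import Defs.
From HB Require Import structures.
From mathcomp Require Import all_boot all_order all_algebra.
From mathcomp Require Import perm generic_quotient ring_quotient complex.
From mathcomp Require Import boolp classical_sets reals.
From mathcomp Require finmap monalg.
From mathcomp Require Import ssrcomplements mpoly.
From mathcomp Require Import ring lra zify.

Set Implicit Arguments.
Unset Strict Implicit.
Unset Printing Implicit Defensive.

Import Order.TTheory GRing.Theory Num.Theory.

Local Open Scope classical_set_scope.
Local Open Scope ring_scope.
Local Open Scope quotient_scope.

(** Write [B = O/(g)], identify [omega_g] with [O], let [J] be the Jacobian
    determinant of [(f, g)] and [s = tau dtau]. The point is that the
    [tau^m omega_tilde_i^j] form a vector space basis of [G_0[tau, tau^-1]] in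
    which [s] is almost diagonal.

    Contracting with the Euler field gives [f dh = deg(h) h df] on the curve
    ([euler_jac]). Hence, if [f omega = u df], then [f du = nu(omega) f omega],
    and [du = nu(omega) omega] because [f] is not a zero divisor in [B]: it
    vanishes on no branch ([nonconstant_nonzerodivisor]). Consequently
    [(s + nu) omega_i^j = 0] at the end [j = N_i] of a Jordan block, where
    moreover [nu >= 0] as the degree of the polynomial [u] ([omega_last]); inside
    a block [s omega_i^j = tau omega_i^(j+1)] by definition. The correction terms
    of [omega_tilde] turn this into
    [(s + lambda_i^j) omega_tilde_i^j = tau omega_tilde_i^(j+1)] (and [0] at the
    end), with all [lambda_i^j] in [[0, 1]] ([shift_omega_tilde]).

    For this to make sense the correction terms must not occur at [j = 0], that
    is, [nu (omega_i^0) <= 1] is needed ([nu_h_le1]). It says that [J] has the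
    largest degree in the Artinian complete intersection [O/(f, g)]. The Bezoutian
    of [(f, g)] proves this without regular sequences or Hilbert series, once [J]
    is nonzero there ([top_degree]); and it is nonzero because there are only
    [mu2] Jordan blocks while [O/(f, g)] has dimension [mu2 + 1] ([jac_notin]).

    The [tau^m omega_tilde] span, and those with [m <= 0] span the lattice,
    because a multiple [u df] can be traded for [tau^-1 du], of smaller degree
    ([mono_span]); they are independent because [J] is not a zero divisor in [B]
    ([omega_tilde_free]).

    Give [tau^m omega_tilde_i^j] the level [lambda_i^j - m]. By the relation
    above the filtration by levels is stable under [s], and [s + l] is nilpotent
    on its [l]-th graded piece, so it contains the filtration by the generalized
    eigenspaces of [s] ([spectral_filtration_descent]); and it is contained in
    that one, being spanned by generalized eigenvectors. The Malgrange-Kashiwara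
    filtration also agrees with it, for its freeness axiom makes it separated
    ([MK_separated]). So the two filtrations are equal ([MK_span_le]), and the
    subquotients in the theorem can be read off the basis
    ([adapted_subquot_basis]). *)

(** * Spans of a family and coordinates *)

Section Span.
Import finmap monalg.
Variables (K : fieldType) (U : lmodType K) (T : choiceType) (b : T -> U).
Implicit Types (P Q : T -> Prop) (c : {malg K[T]}).

Definition lincomb c : U := \sum_(t <- monalg.msupp c) monalg.mcoeff t c *: b t.

Lemma lincombE (d : {fset T}) c : (monalg.msupp c `<=` d)%fset ->
  lincomb c = \sum_(t <- d) monalg.mcoeff t c *: b t.
Proof.
move=> cd; rewrite /lincomb (big_fset_incl _ cd) // => t _ ct.
by rewrite mcoeff_outdom // scale0r.
Qed.

Fact lincomb_linear : linear lincomb.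
Proof.
move=> a x y.
pose d := (monalg.msupp x `|` monalg.msupp y `|` monalg.msupp (a *: x + y)%R)%fset.
have dxy : (monalg.msupp x `|` monalg.msupp y `<=` d)%fset by rewrite fsubsetUl.
have /andP[dx dy] : (monalg.msupp x `<=` d)%fset && (monalg.msupp y `<=` d)%fset.
  by rewrite -fsubUset.
rewrite !(@lincombE d) //; last by rewrite fsubsetUr.
rewrite scaler_sumr -big_split; apply: eq_bigr => t _ /=.
by rewrite raddfD /= monalg.mcoeffZ scalerDl scalerA.
Qed.
HB.instance Definition _ :=
  GRing.isLinear.Build K {malg K[T]} U _ lincomb lincomb_linear.

Lemma lincombU t (a : K) : lincomb << a *g t >> = a *: b t.
Proof.
rewrite (@lincombE [fset t]%fset) ?msuppU_le // big_seq_fset1.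
by rewrite monalg.mcoeffUU.
Qed.

Definition span_on P : set U :=
  [set lincomb c | c in [set c | forall t, monalg.mcoeff t c != 0 -> P t]].

Lemma span_on_subspace P : subspace (span_on P).
Proof.
split; first by exists 0; rewrite ?linear0 // => t; rewrite raddf0 eqxx.
move=> a _ _ [x xP <-] [y yP <-]; exists (a *: x + y); rewrite ?linearP //.
move=> t; rewrite raddfD /= monalg.mcoeffZ.
have [/eqP xt|/xP//] := boolP (monalg.mcoeff t x == 0).
by rewrite xt mulr0 add0r => /yP.
Qed.

Lemma span_on_mem P t : P t -> span_on P (b t).
Proof.
move=> Pt; exists << 1 *g t >>; last by rewrite lincombU scale1r.
by move=> t'; rewrite monalg.mcoeffU; case: (t =P t') => [<- //|_]; rewrite mulr0n eqxx.
Qed.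

Definition free_family : Prop := forall c, lincomb c = 0 -> c = 0.

End Span.

Lemma subspace_sum (K : pzRingType) (U : lmodType K) (S : set U) (I : eqType)
    (r : seq I) (F : I -> U) :
  subspace S -> (forall i, i \in r -> S (F i)) -> S (\sum_(i <- r) F i).
Proof.
move=> [S0 SD] SF; rewrite big_seq; elim/big_ind: _ => //.
by move=> x y Sx Sy; rewrite -[x]scale1r; apply: SD.
Qed.

Lemma subspaceZ (K : pzRingType) (U : lmodType K) (S : set U) (a : K) (x : U) :
  subspace S -> S x -> S (a *: x).
Proof. by move=> [S0 SD] Sx; rewrite -[_ *: _]addr0; apply: SD. Qed.

Lemma subspaceD (K : pzRingType) (U : lmodType K) (S : set U) (x y : U) :
  subspace S -> S x -> S y -> S (x + y).
Proof. by move=> [S0 SD] Sx Sy; rewrite -[x]scale1r; apply: SD. Qed.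

Lemma subspaceB (K : pzRingType) (U : lmodType K) (S : set U) (x y : U) :
  subspace S -> S x -> S y -> S (x - y).
Proof. by move=> [S0 SD] Sx Sy; rewrite addrC -scaleN1r; apply: SD. Qed.

Section SpanTheory.
Import finmap monalg.
Variables (K : fieldType) (U : lmodType K) (T : choiceType) (b : T -> U).
Implicit Types (P Q : T -> Prop) (c : {malg K[T]}).

Lemma span_on_min P (S : set U) :
  subspace S -> (forall t, P t -> S (b t)) -> span_on b P `<=` S.
Proof.
move=> S_sub SP _ [c cP <-]; apply: subspace_sum => // t tc.
apply: subspaceZ => //; apply/SP/cP.
by rewrite monalg.mcoeff_neq0.
Qed.

Lemma span_on_mono P Q : (forall t, P t -> Q t) -> span_on b P `<=` span_on b Q.
Proof. by move=> PQ _ [c cP <-]; exists c => // t /cP/PQ. Qed.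

Lemma span_on_split P P1 P2 x : (forall t, P t -> P1 t \/ P2 t) ->
  span_on b P x -> exists y z, [/\ span_on b P1 y, span_on b P2 z & x = y + z].
Proof.
move=> P12; pose S := [set x | exists y z,
  [/\ span_on b P1 y, span_on b P2 z & x = y + z]].
apply: (span_on_min (S := S)) => [|t /P12[]Pt]; last 2 first.
- exists (b t), 0; split; rewrite ?addr0 //; first exact: span_on_mem.
  exact: (span_on_subspace b P2).1.
- exists 0, (b t); split; rewrite ?add0r //; last exact: span_on_mem.
  exact: (span_on_subspace b P1).1.
split; first by exists 0, 0; split; rewrite ?addr0 //; apply: (span_on_subspace b _).1.
move=> a _ _ [y [z [Py Pz ->]]] [y' [z' [Py' Pz' ->]]].
exists (a *: y + y'), (a *: z + z'); split; last by rewrite scalerDr addrACA.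
  exact: (span_on_subspace b P1).2.
exact: (span_on_subspace b P2).2.
Qed.

Hypothesis free_b : free_family b.

Lemma lincomb_inj : injective (lincomb b).
Proof.
move=> c d e; apply/eqP; rewrite -subr_eq0; apply/eqP/free_b.
by rewrite linearB /= e subrr.
Qed.

Lemma span_on_coef P c : span_on b P (lincomb b c) ->
  forall t, monalg.mcoeff t c != 0 -> P t.
Proof. by move=> [d dP /lincomb_inj <-]. Qed.

Lemma span_on_cap P Q x : span_on b P x -> span_on b Q x ->
  span_on b (fun t => P t /\ Q t) x.
Proof.
by move=> [c cP <-] /span_on_coef cQ; exists c => // t ct; split; auto.
Qed.

Lemma span_on_free P (I : finType) (s : I -> T) (a : I -> K) : injective s ->
  (forall i, ~ P (s i)) -> span_on b P (\sum_i a i *: b (s i)) ->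
  forall i, a i = 0.
Proof.
move=> s_inj sP.
have -> : \sum_i a i *: b (s i) = lincomb b (\sum_i << a i *g s i >>).
  by rewrite linear_sum; apply: eq_bigr => i _; rewrite /= lincombU.
move=> /span_on_coef aP i; apply/eqP/contraT => ai; case: (sP i); apply: aP.
rewrite raddf_sum (bigD1 i) //= big1 => [|j ji].
  by rewrite addr0 monalg.mcoeffUU.
by rewrite monalg.mcoeffU (inj_eq s_inj) (negPf ji).
Qed.

End SpanTheory.

Lemma free_familyP (K : fieldType) (U : lmodType K) (T : choiceType) (b : T -> U) :
  (forall (s : seq T) (c : T -> K), uniq s -> \sum_(t <- s) c t *: b t = 0 ->
    {in s, forall t, c t = 0}) -> free_family b.
Proof.
move=> b_free c c0; apply/monalg.malgP => t; rewrite monalg.mcoeff0.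
have [/eqP //|] := boolP (monalg.mcoeff t c == 0).
rewrite monalg.mcoeff_neq0 => tc.
exact: (b_free _ (fun t => monalg.mcoeff t c) (finmap.fset_uniq _) c0).
Qed.

(** * Filtrations on which an endomorphism has prescribed eigenvalues *)

Lemma common_denominator (A : seq rat) :
  exists2 D : nat, (0 < D)%N & {in A, forall a, exists z : int, a * D%:R = z%:~R}.
Proof.
exists (\prod_(a <- A) `|denq a|%N).
  by rewrite prodn_gt0 // => a; rewrite absz_gt0 denq_neq0.
move=> a aA; have /dvdnP[q ->] : (`|denq a| %| \prod_(a <- A) `|denq a|)%N.
  by rewrite (big_rem a) //= dvdn_mulr.
exists (q%:Z * numq a); rewrite natrM mulrCA intrM; congr (_ * _).
by rewrite natr_absz normr_denq numqE.
Qed.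

Section Descent.
Variables (K : numFieldType) (U : lmodType K) (s : {linear U -> U}).
Implicit Types (a : seq rat) (l m r : rat) (x y : U) (S : set U) (V : rat -> set U).

Definition shift r x : U := s x + ratr r *: x.

Fact shift_linear r : linear (shift r).
Proof.
by move=> k x y; rewrite /shift (linearP s) !scalerDr !scalerA [_ * k]mulrC addrACA.
Qed.
HB.instance Definition _ r := GRing.isLinear.Build K U U _ (shift r) (shift_linear r).

Lemma shiftC r m x : shift r (shift m x) = shift m (shift r x).
Proof.
rewrite /shift !linearD /= !linearZ /= !scalerA [ratr m * _]mulrC.
by rewrite !addrA; congr (_ + _); rewrite addrAC.
Qed.

Definition shifts a x : U := foldl (fun y r => shift r y) x a.

Fact shifts_linear a : linear (shifts a).
Proof.
rewrite /shifts; elim: a => [//|r a IH] k x y /=.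
by rewrite linearP IH.
Qed.
HB.instance Definition _ a := GRing.isLinear.Build K U U _ (shifts a) (shifts_linear a).

Lemma shift_shifts r a x : shift r (shifts a x) = shifts a (shift r x).
Proof. by rewrite /shifts; elim: a x => //= m a IH x; rewrite IH shiftC. Qed.

Lemma shifts_cat a1 a2 x : shifts (a1 ++ a2) x = shifts a2 (shifts a1 x).
Proof. exact: foldl_cat. Qed.

(** The sum of the generalized eigenspaces of [s] for the eigenvalues [- r] with
    [r <= l], described by annihilating products of factors [s + r]. *)
Definition eigen_le l : set U :=
  [set x | exists2 a, all (fun r => r <= l) a & shifts a x = 0].

Lemma eigen_le_subspace l : subspace (eigen_le l).
Proof.
split; first by exists [::].
move=> k x y [a al ax] [a' al' ay]; exists (a ++ a'); first by rewrite all_cat al.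
rewrite shifts_cat linearP /= ax scaler0 add0r.
have H c z : shifts a (shifts c z) = shifts c (shifts a z).
  by rewrite /shifts; elim: a z {al ax} => //= r a IH z; rewrite -IH shift_shifts.
by rewrite -H ay linear0.
Qed.

(** What is kept of the Malgrange-Kashiwara axioms, with [s] the operator
    [tau dtau]: it makes sense for a filtration that is only given as a span, and
    it suffices to compare two filtrations. The discreteness axiom says that the
    jumps have a common denominator. *)
Record spectral_filtration V : Prop := {
  sf_subspace : forall l, subspace (V l);
  sf_increasing : forall l m, l <= m -> V l `<=` V m;
  sf_exhaustive : forall x, exists l, V l x;
  sf_stable : forall l x, V l x -> V l (s x);
  sf_nilpotent : forall l, exists k, forall x, V l x -> Vlt V l (iter k (shift l) x);
  sf_discrete : exists2 D : nat, (0 < D)%N &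
    forall l, V l `<=` V ((Num.floor (l * D%:R))%:~R / D%:R) }.

(** Off [- m], the operator [s + m] is invertible: the factors [s + r] act on
    [x] modulo [S] as the nonzero scalars [r - m]. *)
Lemma shifts_invertible S a m k x : subspace S -> (forall y, S y -> S (s y)) ->
  m \notin a -> S (shifts a x) -> S (iter k (shift m) x) -> S x.
Proof.
move=> S_sub Ss ma; have Ssh r y : S y -> S (shift r y).
  by move=> Sy; apply: subspaceD (Ss _ Sy) _ => //; apply: subspaceZ.
have one y : S (shifts a y) -> S (shift m y) -> S y.
  elim: a y ma => [//|r a IH] y; rewrite inE negb_or => /andP[mr ma] /= Sx Smx.
  have Sy : S (shift r y) by apply: IH => //; rewrite shiftC; apply: Ssh.
  have rm : ratr (r - m) != 0 :> K by rewrite fmorph_eq0 subr_eq0 eq_sym.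
  rewrite -[y]scale1r -(mulVf rm) -scalerA; apply: subspaceZ => //.
  rewrite rmorphB scalerBl.
  have -> : ratr r *: y - ratr m *: y = shift r y - shift m y.
    by rewrite /shift opprD addrACA subrr add0r.
  exact: subspaceB.
elim: k x => [//|k IH] x Sax; rewrite iterSr => Sx.
apply: one => //; apply: IH Sx.
by rewrite -shift_shifts; apply: Ssh.
Qed.

(** One jump at a time: on [gr_M] the operator [s + M] is nilpotent, whereas the
    other factors are invertible, so [x] dies in [gr_M] unless [M] is among the
    annihilating numbers. *)
Lemma spectral_filtration_descent V a x l L : spectral_filtration V ->
  V L x -> shifts a x = 0 -> {in a, forall r, r <= l \/ L < r} -> V l x.
Proof.
move=> [Vsub Vinc _ Vs Vnil [D D0 Vdisc]] Vx ax al.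
have [Ll|lL] := leP L l; first exact: Vinc Vx.
have D0' : 0 < D%:R :> rat by rewrite ltr0n.
(* The jumps in ]l, L] are among the k / D, ..., (k + n) / D. *)
pose k := Num.floor (l * D%:R).
have kl : k%:~R / D%:R <= l by rewrite ler_pdivrMr // floor_le.
have kL : k <= Num.floor (L * D%:R) by rewrite le_floor // ler_pM2r // ltW.
apply: (Vinc _ _ kl).
have /Vdisc := Vx.
have -> : Num.floor (L * D%:R) = k + (`|Num.floor (L * D%:R) - k|%N)%:Z.
  by rewrite gez0_abs ?subr_ge0 // addrCA subrr addr0.
have : k + (`|Num.floor (L * D%:R) - k|%N)%:Z <= Num.floor (L * D%:R).
  by rewrite gez0_abs ?subr_ge0 // addrCA subrr addr0.
elim: `|_|%N => [|n IH]; first by rewrite addr0.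
move=> nL VM; apply: IH; first by move: nL; lia.
have [q] := Vnil ((k + n.+1%:Z)%:~R / D%:R).
move=> /(_ _ VM) [m /= mM Vm].
set M := _ / _ in VM mM Vm.
apply: (shifts_invertible (S := V ((k + n%:Z)%:~R / D%:R)) (a := a)
  (m := M) (k := q)) => //.
- exact: Vs.
- apply/negP => /al[|].
  + rewrite leNgt => /negP; apply; rewrite ltr_pdivlMr //.
    apply: lt_le_trans (floorD1_gt _) _.
    by rewrite ler_int lerD2l; lia.
  + rewrite ltNge => /negP; apply; rewrite ler_pdivrMr //.
    by apply: le_trans (floor_le _); rewrite ler_int.
- by rewrite ax; apply: (Vsub _).1.
- apply: Vinc (Vdisc _ _ Vm).
  rewrite ler_pM2r ?invr_gt0 // ler_int.
  have : Num.floor (m * D%:R) < k + n.+1%:Z.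
    by rewrite floor_lt_int; rewrite ltr_pdivlMr in mM.
  by rewrite -addn1 PoszD addrA -ltzD1.
Qed.

(** Half of the uniqueness of the filtration; the other half needs that no
    nonzero vector lies in all [V m]. *)
Lemma spectral_filtration_eigen V l : spectral_filtration V ->
  eigen_le l `<=` V l.
Proof.
move=> SV x [a al ax]; have [L VL] := sf_exhaustive SV x.
apply: (spectral_filtration_descent SV VL ax) => r /(allP al); by left.
Qed.

(** A factor [s + r] with [r > l] can be dropped from an annihilating product of
    [x]: what it kills in [V l] descends to all [V m]. *)
Lemma spectral_filtration_eigen_le V l x : spectral_filtration V ->
  (forall y, (forall m, V m y) -> y = 0) ->
  (exists a, shifts a x = 0) -> V l x -> eigen_le l x.
Proof.
move=> SV sep [a ax] Vx.
have Vsh r m y : V m y -> V m (shift r y).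
  move=> Vy; apply: subspaceD (sf_stable SV Vy) _; first exact: sf_subspace.
  by apply: subspaceZ => //; apply: sf_subspace.
exists (filter (fun r => r <= l) a); first exact: filter_all.
elim: a x ax Vx => [//|r a IH] x /= ax Vx.
have := IH _ ax (Vsh r _ _ Vx); have [//|lr] := leP r l.
rewrite -shift_shifts => ry; apply: sep => m.
apply: (@spectral_filtration_descent V [:: r] _ m (Num.max l m)) => //.
  apply: (sf_increasing SV (l := l)); first by rewrite le_max lexx.
  rewrite /shifts; elim: (filter _ a) x Vx {ax ry} => [//|r' a' IH'] x Vx /=.
  by apply: IH'; apply: Vsh.
move=> r'; rewrite inE => /eqP ->.
have [rm|mr] := leP r m; first by left.
by right; rewrite gt_max lr.
Qed.

End Descent.

(** * The Malgrange-Kashiwara axioms *)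

Section MalgrangeKashiwara.
Variables (K : numFieldType) (U : lmodType K).
Variables (tau dtau : {linear U -> U}) (V : rat -> set U).
Hypothesis V_MK : MK_filtration tau dtau V.

Lemma poly_actE (q : {poly K}) (n : nat) x : (size q <= n)%N ->
  poly_act tau q x = \sum_(k < n) q`_k *: iter k tau x.
Proof.
move=> qn; rewrite /poly_act (big_ord_widen n (fun k => q`_k *: iter k tau x)) //.
rewrite [RHS](bigID (fun k : 'I_n => (k < size q)%N)) /= [X in _ + X]big1 ?addr0 //.
by move=> k; rewrite -leqNgt => /(nth_default 0) ->; rewrite scale0r.
Qed.

Lemma poly_actB (q r : {poly K}) x :
  poly_act tau (q - r) x = poly_act tau q x - poly_act tau r x.
Proof.
pose n := maxn (size (q - r)%R) (maxn (size q) (size r)).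
rewrite !(@poly_actE _ n) ?leq_max ?leqnn ?orbT // -sumrB.
by apply: eq_bigr => k _; rewrite coefB scalerBl.
Qed.

Lemma poly_actMn (q : {poly K}) k x : poly_act tau (q *+ k) x = poly_act tau q x *+ k.
Proof.
pose n := maxn (size (q *+ k)) (size q).
rewrite !(@poly_actE _ n) ?leq_max ?leqnn ?orbT // -sumrMnl.
by apply: eq_bigr => i _; rewrite coefMn scalerMnl.
Qed.

Lemma poly_actXn (q : {poly K}) k x :
  poly_act tau ('X^k * q) x = iter k tau (poly_act tau q x).
Proof.
rewrite (@poly_actE _ (k + size q)); last first.
  by rewrite mulrC (leq_trans (size_polyMleq _ _)) // size_polyXn addnS addnC.
rewrite big_split_ord /= big1 ?add0r => [|i _]; last by rewrite coefXnM ltn_ord scale0r.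
rewrite /poly_act.
have lin (F : 'I_(size q) -> U) (c : 'I_(size q) -> K) :
    iter k tau (\sum_i c i *: F i) = \sum_i c i *: iter k tau (F i).
  elim: (k) => //= j ->; rewrite linear_sum; apply: eq_bigr => i _.
  by rewrite linearZ.
rewrite lin; apply: eq_bigr => i _.
by rewrite coefXnM ltnNge leq_addr /= addKn iterD.
Qed.

(** The sum over [s] is rewritten over a duplicate-free list: repeated entries
    of [s] contribute through their multiplicities. *)
Lemma tau_free_expand (s s' : seq U) (c : U -> {poly K}) :
  uniq s' -> {subset s <= s'} ->
  \sum_(b <- s) poly_act tau (c b) b =
  \sum_(b <- s') poly_act tau (c b *+ count_mem b s) b.
Proof.
move=> us'; elim: s => [|x s IH] ss'.
  by rewrite big_nil big1 // => b _; rewrite poly_actMn mulr0n.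
rewrite big_cons IH; last by move=> b bs; apply: ss'; rewrite inE bs orbT.
have xs' : x \in s' by apply: ss'; rewrite mem_head.
rewrite [RHS](bigD1_seq x) //= eqxx (bigD1_seq x) //= addrA; congr (_ + _).
  by rewrite !poly_actMn mulrnDr.
by apply: eq_bigr => b /negPf bx; rewrite eq_sym bx.
Qed.

(** A free module over [K[tau]] has no nonzero element that is divisible by
    all powers of [tau]. *)
Lemma MK_separated x : (forall l, V l x) -> x = 0.
Proof.
move=> Vx; have [B [BV spanB freeB]] := MK_free V_MK 0.
have [s [c [sB xE]]] := spanB _ (Vx 0).
(* No coefficient of x has degree k, but all are divisible by 'X^k. *)
pose k := (\max_(b <- s) size (c b *+ count_mem b s)).+1.
have [y Vy xy] : exists2 y, V 0 y & x = iter k tau y.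
  have : V (- k%:R) x by [].
  elim: (k) {xE} x {Vx} => [|i IH] x; first by rewrite oppr0; exists x.
  rewrite -[i.+1]addn1 natrD opprD -(MK_tau V_MK) => -[z /IH[y Vy zy] <-].
  by exists y; rewrite ?addn1 //= -zy.
have [s' [c' [s'B yE]]] := spanB _ Vy.
pose t := undup (s ++ s').
have ut : uniq t by apply: undup_uniq.
have tE : x = \sum_(b <- t) poly_act tau (c b *+ count_mem b s) b.
  by rewrite xE; apply: tau_free_expand => // b bs; rewrite mem_undup mem_cat bs.
have tE' : x = \sum_(b <- t) poly_act tau ('X^k * (c' b *+ count_mem b s')) b.
  rewrite xy yE (tau_free_expand _ ut); last first.
    by move=> b bs; rewrite mem_undup mem_cat bs orbT.
  under [RHS]eq_bigr do rewrite poly_actXn.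
  elim: (k) => //= j ->; first by rewrite linear_sum.
have /(freeB _ _ ut) t0 : [set` t] `<=` B.
  by move=> b /=; rewrite mem_undup mem_cat => /orP[/sB|/s'B].
have : \sum_(b <- t) poly_act tau (c b *+ count_mem b s
    - 'X^k * (c' b *+ count_mem b s')) b = 0.
  by under eq_bigr do rewrite poly_actB; rewrite sumrB -tE -tE' subrr.
move=> /t0 {}t0; rewrite tE big_seq big1 // => b bt.
have [bs|bs] := boolP (b \in s); last first.
  by rewrite (count_memPn bs) poly_actMn mulr0n.
have /eqP := t0 b bt; rewrite subr_eq0 => /eqP cE.
have : (size (c b *+ count_mem b s) < k)%N.
  by rewrite ltnS; apply: (@leq_bigmax_seq _ _ _ (fun b => size (c b *+ _))).
have [c'0|d0] := eqVneq (c' b *+ count_mem b s') 0.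
  by rewrite cE c'0 mulr0 /poly_act size_poly0 big_ord0.
by rewrite cE mulrC size_mulXn // => /(leq_ltn_trans (leq_addr _ _)); rewrite ltnn.
Qed.

Lemma MK_spectral : spectral_filtration (tau \o dtau) V.
Proof.
have subV l := MK_subspace V_MK l.
split=> //; [exact: (MK_increasing V_MK)|exact: (MK_exhaustive V_MK)| | |].
- move=> l x Vx /=; have := MK_dtau V_MK (l := l) (imageP dtau Vx).
  move=> Vdx; have : (tau @` V (l + 1)) (tau (dtau x)) by exists (dtau x).
  by rewrite (MK_tau V_MK) addrK.
- by move=> l; have [k] := MK_nilpotent V_MK l; exists k.
have [A [_ discA]] := MK_discrete V_MK.
have [D D0 denA] := common_denominator A; exists D => // l x Vx.
have [l' [[a aA [z _ l'E]] l'l _] VE] := discA l.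
have D0' : 0 < D%:R :> rat by rewrite ltr0n.
have [z' z'E] : exists z' : int, l' * D%:R = z'%:~R.
  have [z' z'E] := denA a aA; exists (z' + z * D%:Z).
  by rewrite -l'E mulrDl z'E intrD intrM.
rewrite VE in Vx; apply: (MK_increasing V_MK) Vx.
by rewrite ler_pdivlMr // z'E ler_int floor_ge_int -z'E ler_pM2r.
Qed.

End MalgrangeKashiwara.

(** * Subquotients and bases adapted to a filtration *)

Section SubquotDim.
Variables (K : fieldType) (U : lmodType K) (A B : set U).

Lemma subquot_basis_dim (I : finType) (v : I -> U) :
  subquot_basis A B v -> subquot_dim A B #|I|.
Proof.
move=> [vA vspan vfree]; exists (v \o enum_val); split.
- by move=> i; apply: vA.
- move=> x /vspan[c cP]; exists (c \o enum_val).
  rewrite (reindex (@enum_val I xpredT)) /= in cP; first exact: cP.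
  exact: onW_bij (enum_val_bij I).
move=> c cB i; rewrite -(enum_valK i).
apply: (vfree (c \o enum_rank) _ (enum_val i)).
rewrite (reindex (@enum_val I xpredT)) /=; last exact: onW_bij (enum_val_bij I).
by under eq_bigr do rewrite enum_valK.
Qed.

Hypothesis B_sub : subspace B.

Lemma subquot_basis_leq d d' (v : 'I_d -> U) (w : 'I_d' -> U) :
  subquot_basis A B v -> subquot_basis A B w -> (d <= d')%N.
Proof.
move=> [vA _ vfree] [_ wspan _].
have /choice[M MP] i := wspan _ (vA i).
suff /eqP <- : row_free (\matrix_(i, j) M i j) by apply: rank_leq_col.
apply/inj_row_free => u /rowP uM; apply/rowP => i; rewrite mxE.
apply: (vfree (u 0)).
have -> : \sum_i u 0 i *: v i = \sum_i u 0 i *: (v i - \sum_j M i j *: w j).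
  rewrite [RHS](eq_bigr (fun i => u 0 i *: v i - \sum_j (u 0 i * M i j) *: w j)).
    rewrite sumrB exchange_big /= [X in _ - X]big1 ?subr0 // => j _.
    rewrite -scaler_suml; have := uM j; rewrite !mxE => uMj.
    rewrite [X in X *: _](_ : _ = 0) ?scale0r //; apply: etrans uMj.
    by apply: eq_bigr => k _; rewrite mxE.
  move=> k _; rewrite scalerBr scaler_sumr; congr (_ - _).
  by apply: eq_bigr => j _; rewrite scalerA.
by apply: subspace_sum => // k _; apply: subspaceZ.
Qed.

Lemma subquot_dim_uniq d d' : subquot_dim A B d -> subquot_dim A B d' -> d = d'.
Proof.
move=> [v vb] [w wb]; apply/eqP; rewrite eqn_leq.
by rewrite (subquot_basis_leq vb wb) (subquot_basis_leq wb vb).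
Qed.

End SubquotDim.

(** The family [b (k, m)] stands for [tau^m b_k], where the [b_k] form a basis
    over the Laurent polynomials in [tau]; [nxt] arranges the [b_k] in finite
    chains on which [s + lam k] acts as [tau] times the shift. The filtration has
    to be the one by the levels [lam k - m]. *)
Section Adapted.
Import finmap monalg.
Variables (K : numFieldType) (U : lmodType K) (s : {linear U -> U}).
Variables (idx : finType) (b : idx * int -> U) (lam : idx -> rat).
Variables (nxt : idx -> option idx) (rk : idx -> nat).
Hypothesis b_free : free_family b.
Hypothesis b_span : forall x, span_on b (fun=> True) x.
Hypothesis lam01 : forall k, 0 <= lam k <= 1.
Hypothesis nxt_rk : forall k k', nxt k = Some k' -> (rk k' < rk k)%N.
Hypothesis b_shift : forall k m,
  shift s (lam k - m%:~R) (b (k, m)) = oapp (fun k' => b (k', m + 1)) 0 (nxt k).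
Implicit Types (l : rat) (t : idx * int).

Definition level t : rat := lam t.1 - t.2%:~R.

Definition span_le l : set U := span_on b (fun t => level t <= l).

Lemma span_le_subspace l : subspace (span_le l).
Proof. exact: span_on_subspace. Qed.

Lemma span_le_mono l m : l <= m -> span_le l `<=` span_le m.
Proof. by move=> lm; apply: span_on_mono => t /le_trans; apply. Qed.

Lemma level_nxt k k' m : level (k', m + 1) <= level (k, m).
Proof.
rewrite /level /= intrD; have /andP[k0 _] := lam01 k; have /andP[_ k1] := lam01 k'.
by lra.
Qed.

Lemma shift_span_le r l : span_le l `<=` shift s r @^-1` span_le l.
Proof.
apply: span_on_min => [|[k m] kl].
  have [S0 SD] := span_le_subspace l.
  by split=> [|a x y Sx Sy] /=; rewrite ?linear0 ?linearP //; apply: SD.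
rewrite /preimage /=; have -> : shift s r (b (k, m)) =
    shift s (lam k - m%:~R) (b (k, m)) + ratr (r - level (k, m)) *: b (k, m).
  rewrite /shift -addrA -scalerDl -rmorphD; congr (_ + ratr _ *: _).
  by rewrite /level /=; ring.
apply: subspaceD (span_le_subspace l) _ _; last first.
  by apply: subspaceZ (span_le_subspace l) _; apply: span_on_mem.
rewrite b_shift; case: (nxt k) => [k'|] /=; last exact: (span_le_subspace l).1.
by apply: span_on_mem; apply: le_trans kl; apply: level_nxt.
Qed.

Lemma span_le_eigen l : span_le l `<=` eigen_le s l.
Proof.
apply: span_on_min => [|[k m]]; first exact: eigen_le_subspace.
move: {2}(rk k) (leqnn (rk k)) => n; elim: n k m l => [|n IH] k m l kn kl.
  exists [:: level (k, m)]; rewrite /= ?kl // b_shift.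
  by case: (nxt k) (@nxt_rk k) => //= k' /(_ _ erefl) /leq_trans/(_ kn); rewrite ltn0.
have [a al ax] : eigen_le s l (shift s (level (k, m)) (b (k, m))).
  rewrite b_shift; case: (nxt k) (@nxt_rk k) => [k' /(_ _ erefl) kk'|_] /=.
    apply: IH; first by rewrite -ltnS (leq_trans kk').
    by apply: le_trans kl; apply: level_nxt.
  exact: (eigen_le_subspace s l).1.
by exists (level (k, m) :: a); rewrite //= kl.
Qed.

(** On [gr_l] the operator [s + l] sends the class of a basis vector to that of
    the next one. One step keeps the level only from [lam = 0] to [lam = 1], so
    two steps never do: hence the square. *)
Lemma span_le_nilpotent l x : span_le l x -> Vlt span_le l (iter 2 (shift s l) x).
Proof.
move: x; apply: (@span_on_min _ _ _ _ _ [set x | Vlt span_le l (iter 2 (shift s l) x)]).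
  split=> [|a x y [m ml mx] [m' m'l m'y]].
    exists (l - 1); first by rewrite /= ltrBlDr ltrDl.
    by rewrite /= !linear0; apply: (span_le_subspace _).1.
  exists (Num.max m m'); first by rewrite /= gt_max ml m'l.
  rewrite /= !linearP; apply: (span_le_subspace _).2.
    by apply: span_le_mono mx; rewrite le_max lexx.
  by apply: span_le_mono m'y; rewrite le_max lexx orbT.
move=> [k m] kl; have [kl'|lk|kl'] := ltgtP (level (k, m)) l.
- exists (level (k, m)) => //=; do 2!apply: shift_span_le.
  exact: span_on_mem.
- by rewrite leNgt lk in kl.
rewrite /= -kl' b_shift; case: (nxt k) => [k'|] /=; last first.
  exists (level (k, m) - 1); first by rewrite /= ltrBlDr ltrDl.
  by rewrite linear0; apply: (span_le_subspace _).1.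
have := level_nxt k k' m; rewrite le_eqVlt => /orP[/eqP kk'|].
  rewrite -kk' b_shift; case: (nxt k') => [k''|] /=; last first.
    exists (level (k', m + 1) - 1); first by rewrite /= ltrBlDr ltrDl.
    exact: (span_le_subspace _).1.
  exists (level (k'', m + 1 + 1)); last exact: span_on_mem.
  move: kk'; rewrite /level /= !intrD.
  by have /andP[? _] := lam01 k; have /andP[_ ?] := lam01 k''; lra.
move=> lt; exists (level (k', m + 1)) => //.
by apply: shift_span_le; apply: span_on_mem.
Qed.

Lemma span_le_spectral : spectral_filtration s span_le.
Proof.
split.
- exact: span_le_subspace.
- exact: span_le_mono.
- move=> x; have [c _ <-] := b_span x.
  exists (\sum_(t <- monalg.msupp c) `|level t|).
  exists c => // t; rewrite monalg.mcoeff_neq0 => tc.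
  rewrite (big_rem t) //=; apply: le_trans (ler_norm _) _.
  by rewrite lerDl sumr_ge0.
- move=> l x /(@shift_span_le 0 l); rewrite /= /shift rmorph0 scale0r addr0.
  by [].
- by move=> l; exists 2 => x; apply: span_le_nilpotent.
have [D D0 denA] := common_denominator (codom lam); exists D => // l.
apply: span_on_mono => -[k m] kl.
have D0' : 0 < D%:R :> rat by rewrite ltr0n.
have [z zE] := denA _ (codom_f lam k).
have zE' : level (k, m) * D%:R = (z - m * D%:Z)%:~R.
  by rewrite /level mulrBl zE intrB intrM.
by rewrite ler_pdivlMr // zE' ler_int floor_ge_int -zE' ler_pM2r.
Qed.

Variables (tau dtau : {linear U -> U}) (V : rat -> set U).
Hypothesis V_MK : MK_filtration tau dtau V.
Hypothesis sE : s =1 tau \o dtau.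

(** Both filtrations are the filtration by generalized eigenspaces. *)
Lemma MK_span_le l : V l = span_le l.
Proof.
have VS : spectral_filtration s V.
  have [? ? ? Vs Vn ?] := MK_spectral V_MK; split=> // [l' x|l'].
    by rewrite sE; apply: Vs.
  have [k kP] := Vn l'; exists k => x /kP.
  congr (Vlt V l' _); apply: eq_iter => y.
  by rewrite /shift sE.
rewrite eqEsubset; split=> x Vx.
  apply: spectral_filtration_eigen; first exact: span_le_spectral.
  apply: (spectral_filtration_eigen_le VS) Vx; first exact: MK_separated V_MK.
  have [L /span_le_eigen[a _ ax]] := sf_exhaustive span_le_spectral x.
  by exists a.
exact: spectral_filtration_eigen VS _ (span_le_eigen Vx).
Qed.

Variables (tauV : U -> U) (G : set U).
Hypothesis G_span : G = span_on b (fun t => t.2 <= 0).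
Hypothesis tauVG_span : tauV @` G = span_on b (fun t => t.2 <= -1).

Lemma Vlt_span l : Vlt V l = span_on b (fun t => level t < l).
Proof.
rewrite eqEsubset; split=> x.
  case=> m /= ml; rewrite MK_span_le; apply: span_on_mono => t /le_lt_trans.
  by apply.
move: x; apply: span_on_min => [|t tl]; last first.
  by exists (level t) => //; rewrite MK_span_le; apply: span_on_mem.
split=> [|a x y [m ml mx] [m' m'l m'y]].
  exists (l - 1); first by rewrite /= ltrBlDr ltrDl.
  by rewrite MK_span_le; apply: (span_le_subspace _).1.
exists (Num.max m m'); first by rewrite /= gt_max ml m'l.
rewrite !MK_span_le in mx m'y *; apply: (span_le_subspace _).2.
  by apply: span_le_mono mx; rewrite le_max lexx.
by apply: span_le_mono m'y; rewrite le_max lexx orbT.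
Qed.

Lemma gr_num_span l :
  gr_num V G l = span_on b (fun t => level t <= l /\ t.2 <= 0).
Proof.
rewrite /gr_num MK_span_le G_span eqEsubset; split=> x.
  by case; apply: span_on_cap.
by move=> xP; split; apply: span_on_mono xP => t [].
Qed.

(** Since [0 <= lam <= 1], a basis vector of level at most [l] with [m <= 0] is in
    [tau^-1 G], or has smaller level, or is some [b_k] with [lam k = l]. *)
Lemma gr_den_span l : gr_den tauV V G l =
  span_on b (fun t => [/\ level t <= l, t.2 <= 0 & ~~ ((t.2 == 0) && (lam t.1 == l))]).
Proof.
rewrite /gr_den MK_span_le tauVG_span Vlt_span G_span eqEsubset; split=> x.
  case=> y [yl y0] [z [zl z0]] <-; apply: subspaceD (span_on_subspace _ _) _ _.
    apply: span_on_mono (span_on_cap b_free yl y0) => -[k m] /= [kl m0].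
    split=> //; first by apply: le_trans m0 _.
    by apply/negP => /andP[/eqP m00]; rewrite m00 in m0.
  apply: span_on_mono (span_on_cap b_free zl z0) => -[k m] /= [kl m0].
  split=> //; first exact: ltW.
  by apply/negP => /andP[/eqP m00 /eqP kl']; rewrite /level /= m00 subr0 kl' ltxx in kl.
move=> xP; have [|y [z [yP zP ->]]] := span_on_split
    (P1 := fun t => level t <= l /\ t.2 <= -1)
    (P2 := fun t => level t < l /\ t.2 <= 0) _ xP.
  move=> [k m] /= [kl m0]; rewrite negb_and => /orP[m1|kl'].
    by left; split=> //; lia.
  have [/eqP m00|m1] := boolP (m == 0); last by left; split=> //; lia.
  right; split=> //; rewrite lt_neqAle kl andbT.
  by rewrite /level /= m00 subr0.
exists y; first by split; apply: span_on_mono yP => t [].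
by exists z => //; split; apply: span_on_mono zP => t [].
Qed.

Lemma adapted_subquot_basis l :
  subquot_basis (gr_num V G l) (gr_den tauV V G l)
    (fun k : {k : idx | lam k == l} => b (val k, 0)).
Proof.
rewrite gr_num_span gr_den_span; split.
- move=> k; apply: span_on_mem; split=> //=.
  by rewrite /level /= subr0 (eqP (valP k)).
- move=> x xP.
  have [|y [z [[c cP <-] zP ->]]] := span_on_split
      (P1 := fun t => t.2 = 0 /\ lam t.1 = l)
      (P2 := fun t =>
        [/\ level t <= l, t.2 <= 0 & ~~ ((t.2 == 0) && (lam t.1 == l))]) _ xP.
    move=> t [tl t0].
    have [/andP[/eqP ? /eqP ?]|tn] := boolP ((t.2 == 0) && (lam t.1 == l)).
      by left.
    by right.
  exists (fun k => monalg.mcoeff (val k, 0) c).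
  suff -> : lincomb b c =
      \sum_(k : {k | lam k == l}) monalg.mcoeff (val k, 0) c *: b (val k, 0).
    by rewrite addrAC subrr add0r.
  rewrite -[RHS](eq_bigr _ (fun k _ => lincombU b (val k, 0) _)) -linear_sum.
  congr (lincomb b _); apply/malgP => t; rewrite raddf_sum /=.
  have [/eqP ct|/[dup] ct /cP[t0 tl]] := boolP (monalg.mcoeff t c == 0).
    rewrite ct big1 // => k _; rewrite monalg.mcoeffU.
    by case: (_ =P t) => [->|//]; rewrite ct.
  have /eqP tl' := tl; have tE : t = (val (exist (fun k => lam k == l) t.1 tl'), 0).
    by rewrite /= -t0; case: (t).
  rewrite (bigD1 (exist _ t.1 tl')) //= big1 => [|k kt].
    by rewrite -t0 addr0 -surjective_pairing monalg.mcoeffUU.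
  rewrite monalg.mcoeffU; case: eqP => // kE; case/eqP: kt; apply: val_inj => /=.
  by rewrite -kE.
move=> a; apply: (span_on_free b_free).
  by move=> k k' [/val_inj].
by move=> k [_ _]; rewrite /= (valP k).
Qed.

Lemma adapted_subquot_dim l :
  subquot_dim (gr_num V G l) (gr_den tauV V G l) #|[pred k | lam k == l]|.
Proof.
by have := subquot_basis_dim (adapted_subquot_basis l); rewrite card_sig.
Qed.

Lemma adapted_spectrum : spectrum tauV V G =
  [set ld | (exists k, lam k = ld.1) /\ ld.2 = #|[pred k | lam k == ld.1]|].
Proof.
rewrite eqEsubset; split=> -[l d] /=.
  case=> d0 dP; have dE : d = #|[pred k | lam k == l]|.
    apply: subquot_dim_uniq dP (adapted_subquot_dim l).
    by rewrite gr_den_span; apply: span_on_subspace.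
  split=> //; have /card_gt0P[k /eqP kl] : (0 < #|[pred k | lam k == l]|)%N.
    by rewrite -dE lt0n; apply/eqP.
  by exists k.
move=> [[k kl] ->]; split; last exact: adapted_subquot_dim.
by apply/eqP; rewrite -lt0n; apply/card_gt0P; exists k; apply/eqP.
Qed.

End Adapted.

(** * Weights, Jacobian determinants and the Euler field *)

Lemma mnm_neq0_gt0 n (m : 'X_{1..n}) : m != 0%MM -> exists i, (0 < m i)%N.
Proof.
apply: contra_neqP => /forallNP m0; apply/mnmP => i; rewrite mnm0E.
by case: (posnP (m i)) (m0 i).
Qed.

Lemma mnm_subUK n (m : 'X_{1..n}) i : (0 < m i)%N -> (U_(i) + (m - U_(i)))%MM = m.
Proof.
by move=> mi; apply/mnmP => j; rewrite mnmDE mnmBE mnm1E; case: eqP => [<-|_] /=; lia.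
Qed.

Section Weights.
Variables (K : numFieldType) (n : nat) (p : 'I_n.+1 -> rat).
Local Notation O := {mpoly K[n.+1]}.
Implicit Types (q a : O) (d : rat) (P : pred rat).

Lemma weightD m1 m2 : weight p (m1 + m2)%MM = weight p m1 + weight p m2.
Proof.
by rewrite /weight -big_split; apply: eq_bigr => i _; rewrite mnmDE mulrnDr.
Qed.

Lemma weightU i : weight p U_(i)%MM = p i.
Proof.
rewrite /weight (bigD1 i) //= big1 => [|j ji]; first by rewrite mnm1E eqxx addr0.
by rewrite mnm1E eq_sym (negPf ji).
Qed.

Lemma weight0 : weight p 0%MM = 0.
Proof. by rewrite /weight big1 // => i _; rewrite mnm0E. Qed.

Lemma whomogP d q : whomog p d q <-> forall m, q@_m != 0 -> weight p m = d.
Proof. by split=> qd m; have := qd m; rewrite mcoeff_msupp. Qed.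

Lemma whomog0 d : whomog p d (0 : O).
Proof. by move=> m; rewrite msupp0. Qed.

Lemma whomogD d q a : whomog p d q -> whomog p d a -> whomog p d (q + a).
Proof. by move=> qd ad m /msuppD_le; rewrite mem_cat => /orP[/qd|/ad]. Qed.

Lemma whomogM d d' q a : whomog p d q -> whomog p d' a -> whomog p (d + d') (q * a).
Proof.
move=> qd ad m /msuppM_le/allpairsP[[m1 m2] /= [/qd <- /ad <- ->]].
exact: weightD.
Qed.

Lemma whomogC (c : K) : whomog p 0 c%:MP.
Proof.
by apply/whomogP => m; rewrite mcoeffC; case: (m =P 0%MM) => [->|_];
  rewrite ?weight0 ?mulr0 ?eqxx.
Qed.

Lemma whomogZ d (c : K) q : whomog p d q -> whomog p d (c *: q).
Proof. by move=> qd; rewrite -mul_mpolyC -[d]add0r; apply/whomogM/qd/whomogC. Qed.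

Lemma whomogN d q : whomog p d q -> whomog p d (- q).
Proof. by move=> qd; rewrite -scaleN1r; apply: whomogZ. Qed.

Lemma whomogMX d q a k : whomog p d q -> whomog p 1 a ->
  whomog p (d + k%:R) (a ^+ k * q).
Proof.
move=> qd a1; elim: k => [|k IH]; first by rewrite expr0 mul1r addr0.
by rewrite exprS -mulrA -addn1 natrD addrA addrC; apply: whomogM.
Qed.

Lemma whomogX m : whomog p (weight p m) ('X_[m] : O).
Proof. by move=> m'; rewrite msuppX inE => /eqP ->. Qed.

Lemma whomog_mderiv d q i : whomog p d q -> whomog p (d - p i) q^`M(i).
Proof.
move=> qd; rewrite [q]mpolyE raddf_sum /= big_seq; elim/big_ind: _ => //.
- exact: whomog0.
- by move=> a b; apply: whomogD.
move=> m /qd <-; rewrite mderivZ mderivX; apply: whomogZ.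
case: (posnP (m i)) => [->|mi]; first by rewrite scale0r; apply: whomog0.
apply: whomogZ; rewrite -{1}(mnm_subUK mi) weightD weightU addrAC subrr add0r.
exact: whomogX.
Qed.

Lemma whomog_wdeg d q : whomog p d q -> q != 0 -> wdeg p q = d.
Proof. by move=> qd q0; apply: qd; apply: mlead_supp. Qed.

(** Keeping the monomials whose weight satisfies [P] covers both homogeneous
    components and truncations; it commutes, up to a shift of [P], with the
    multiplication by a homogeneous polynomial, hence preserves homogeneous
    ideals. *)
Definition wfilter P q : O :=
  \sum_(m <- msupp q | P (weight p m)) q@_m *: 'X_[m].

Lemma mcoeff_wfilter P q m :
  (wfilter P q)@_m = if P (weight p m) then q@_m else 0.
Proof.
rewrite raddf_sum /=.
under eq_bigr do rewrite mcoeffZ mcoeffX.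
have [qm|/memN_msupp_eq0 qm] := boolP (m \in msupp q).
  rewrite big_mkcond (bigD1_seq m) ?msupp_uniq //= big1 => [|m' /negPf ->].
    by rewrite eqxx mulr1 addr0.
  by rewrite mulr0 if_same.
rewrite qm if_same big1 // => m' _; case: eqP => [->|]; rewrite ?qm ?mul0r ?mulr0 //.
Qed.

Fact wfilter_linear P : linear (wfilter P).
Proof.
move=> c q a; apply/mpolyP => m; rewrite mcoeffD mcoeffZ !mcoeff_wfilter.
by rewrite mcoeffD mcoeffZ; case: ifP => _; rewrite ?mulr0 ?addr0.
Qed.
HB.instance Definition _ P := GRing.isLinear.Build K O O _ (wfilter P)
  (wfilter_linear P).

Lemma wfilter_id P q : (forall m, m \in msupp q -> P (weight p m)) -> wfilter P q = q.
Proof.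
move=> qP; apply/mpolyP => m; rewrite mcoeff_wfilter; case: ifP => // Pm.
by apply/esym/memN_msupp_eq0/negP => /qP; rewrite Pm.
Qed.

Lemma wfilter_eq0 P q : (forall m, m \in msupp q -> ~~ P (weight p m)) ->
  wfilter P q = 0.
Proof.
move=> qP; apply/mpolyP => m; rewrite mcoeff_wfilter mcoeff0; case: ifP => // Pm.
by apply/memN_msupp_eq0/negP => /qP; rewrite Pm.
Qed.

Lemma wfilter_whomog P d q : whomog p d q -> wfilter P q = if P d then q else 0.
Proof.
move=> qd; case: ifP => Pd; first by rewrite wfilter_id // => m /qd ->.
by rewrite wfilter_eq0 // => m /qd ->; rewrite Pd.
Qed.

Lemma wfilterM P d q a : whomog p d a ->
  wfilter P (q * a) = wfilter (fun r => P (r + d)) q * a.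
Proof.
move=> ad; rewrite {1}[q]mpolyE mulr_suml linear_sum /= [in RHS]/wfilter mulr_suml.
rewrite [RHS]big_mkcond.
apply: eq_bigr => m _; rewrite -scalerAl linearZ /=.
rewrite (wfilter_whomog _ (whomogM (@whomogX m) ad)).
by case: ifP; rewrite ?scaler0 // scalerAl.
Qed.

Hypothesis p_gt0 : forall i, 0 < p i.

Lemma weight_ge0 m : 0 <= weight p m.
Proof. by apply: sumr_ge0 => i _; rewrite mulrn_wge0 // ltW. Qed.

Lemma weight_gt0 m : m != 0%MM -> 0 < weight p m.
Proof.
move=> /mnm_neq0_gt0[i mi].
rewrite /weight (bigD1 i) //= ltr_wpDr ?sumr_ge0 //; last by rewrite pmulrn_rgt0.
by move=> j _; rewrite mulrn_wge0 // ltW.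
Qed.

Lemma whomog_ge0 d q : whomog p d q -> q != 0 -> 0 <= d.
Proof. by move=> qd q0; rewrite -(whomog_wdeg qd q0); apply: weight_ge0. Qed.

Lemma euler d q : whomog p d q ->
  \sum_j ratr (p j) *: 'X_j * q^`M(j) = ratr d *: q.
Proof.
move=> qd; transitivity
    (\sum_(m <- msupp q) (ratr (weight p m) * q@_m) *: 'X_[m] : O); last first.
  rewrite [in RHS](mpolyE q) scaler_sumr big_seq [RHS]big_seq.
  by apply: eq_bigr => m /qd ->; rewrite scalerA.
rewrite {1}[q]mpolyE.
under eq_bigr do rewrite raddf_sum mulr_sumr.
rewrite exchange_big; apply: eq_bigr => m _ /=.
rewrite /weight rmorph_sum mulr_suml scaler_suml; apply: eq_bigr => j _.
rewrite mderivZ mderivX rmorphMn /= -scalerAl.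
case: (posnP (m j)) => [->|mj].
  by rewrite mulr0n mul0r !scale0r scaler0 mulr0 scaler0.
rewrite -!scalerAr -mpolyXD mnm_subUK //.
by rewrite !scalerA -mulr_natr; congr (_ *: _); ring.
Qed.

End Weights.

Section Ideals.
Variables (K : numFieldType) (n : nat).
Local Notation O := {mpoly K[n.+1]}.
Implicit Types (I : set O) (f q a : O) (g : 'I_n -> O) (p : 'I_n.+1 -> rat).

Definition is_ideal I : Prop := subspace I /\ forall a q, I q -> I (a * q).

Lemma base_ideal_is_ideal g : is_ideal (base_ideal g).
Proof.
split; [split|].
- by exists (fun=> 0); rewrite big1 // => i _; rewrite mul0r.
- move=> c _ _ [x ->] [y ->]; exists (fun i => c *: x i + y i).
  rewrite scaler_sumr -big_split; apply: eq_bigr => i _ /=.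
  by rewrite mulrDl scalerAl.
- move=> a _ [x ->]; exists (fun i => a * x i).
  by rewrite mulr_sumr; apply: eq_bigr => i _; rewrite mulrA.
Qed.

Lemma base_ideal_mem g i : base_ideal g (g i).
Proof.
exists (fun j => (i == j)%:R); rewrite (bigD1 i) //= eqxx mul1r big1 ?addr0 //.
by move=> j; rewrite eq_sym => /negPf ->; rewrite mul0r.
Qed.

Lemma ideal_add_is_ideal f I : is_ideal I -> is_ideal (ideal_add f I).
Proof.
move=> [I_sub IM]; split; [split|].
- by exists 0; rewrite mul0r subr0; apply: I_sub.1.
- move=> c x y [u xu] [v yv]; exists (c *: u + v).
  rewrite mulrDl -scalerAl opprD addrACA -scalerBr; exact: I_sub.2.
- by move=> a q [u qu]; exists (a * u); rewrite -mulrA -mulrBr; apply: IM.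
Qed.

Lemma ideal_addl f I q : is_ideal I -> I q -> ideal_add f I q.
Proof. by move=> _ Iq; exists 0; rewrite mul0r subr0. Qed.

Lemma ideal_addr f I a : is_ideal I -> ideal_add f I (a * f).
Proof. by move=> [I_sub _]; exists a; rewrite subrr; apply: I_sub.1. Qed.

Lemma base_ideal_wfilter p P g (e : 'I_n -> rat) q :
  (forall i, whomog p (e i) (g i)) -> base_ideal g q -> base_ideal g (wfilter p P q).
Proof.
move=> ge [c ->]; exists (fun i => wfilter p (fun r => P (r + e i)) (c i)).
by rewrite linear_sum; apply: eq_bigr => i _; rewrite /= (wfilterM _ _ (ge i)).
Qed.

End Ideals.

(** The notion of degree [H] is abstract because it is used for homogeneity and
    for degree bounds in one group of variables only. *)
Lemma graded_det (R : comNzRingType) (H : rat -> R -> Prop)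
    (H0 : forall d, H d 0) (HD : forall d x y, H d x -> H d y -> H d (x + y))
    (HN : forall d x, H d x -> H d (- x)) (H1 : H 0 1)
    (HM : forall d d' x y, H d x -> H d' y -> H (d + d') (x * y))
    (k : nat) (A : 'M[R]_k) (d r : 'I_k -> rat) :
  (forall i j, H (d i - r j) (A i j)) -> H (\sum_i d i - \sum_j r j) (\det A).
Proof.
move=> HA; rewrite /determinant; apply: big_ind => [||s _]; [exact: H0|exact: HD|].
have Hs : H (\sum_i d i - \sum_j r j) (\prod_i A i (s i)).
  rewrite [\sum_j r j](reindex_perm s) -sumrB.
  by elim/big_rec2: _ => // i x y _; apply: HM.
by rewrite mulr_sign; case: ifP => _ //; apply: HN.
Qed.

Section Jacobian.
Variables (K : numFieldType) (n : nat) (p : 'I_n.+1 -> rat).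
Local Notation O := {mpoly K[n.+1]}.
Variables (g : 'I_n -> O) (e : 'I_n -> rat).
Hypothesis g_homog : forall i, whomog p (e i) (g i).

Lemma jac_homog d h : whomog p d h ->
  whomog p (d + \sum_i e i - \sum_i p i) (jac g h).
Proof.
move=> hd.
have -> : d + \sum_i e i = \sum_i oapp e d (unlift ord0 i).
  rewrite big_ord_recl unlift_none; congr (_ + _).
  by apply: eq_bigr => i _; rewrite liftK.
apply: graded_det.
- exact: whomog0.
- by move=> *; apply: whomogD.
- by move=> *; apply: whomogN.
- by rewrite -mpolyC1; apply: whomogC.
- by move=> *; apply: whomogM.
move=> i j; rewrite mxE; apply: whomog_mderiv.
by case: (unlift ord0 i) => [k|] //=.
Qed.

Lemma jac_wlt (r : rat) q : (forall m, m \in msupp q -> weight p m < r) ->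
  forall m, m \in msupp (jac g q) -> weight p m < r + \sum_i e i - \sum_i p i.
Proof.
move=> qr m; rewrite mcoeff_msupp.
have -> : (jac g q)@_m = \sum_(m' <- msupp q) q@_m' * (jac g 'X_[m'])@_m.
  rewrite {1}[q]mpolyE (linear_sum (jac g)) (raddf_sum (mcoeff m)).
  by apply: eq_bigr => m' _; rewrite -mcoeffZ -linearZ.
apply: contraR => mr; rewrite big_seq big1 // => m' /qr m'r.
apply/eqP; rewrite mulf_eq0; apply/orP; right.
apply: contraNT mr; rewrite -mcoeff_msupp => /(jac_homog (@whomogX _ _ p m')) ->.
by rewrite -!addrA ltrD2r.
Qed.

(** Contracting with the Euler field, which is tangent to [g = 0]: by Cramer's
    rule the minors of the Jacobian matrix of [g] are, modulo [g], proportional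
    to the coordinates. *)
Lemma euler_minors f : whomog p 1 f -> exists c : 'I_n.+1 -> O,
  (forall h, jac g h = \sum_j h^`M(j) * c j) /\
  (forall j, base_ideal g (ratr (p j) *: 'X_j * jac g f - c j * f)).
Proof.
move=> f1; pose A h : 'M[O]_n.+1 :=
  \matrix_(i, j) (oapp g h (unlift ord0 i))^`M(j).
exists (fun j => cofactor (A f) ord0 j); split=> [h|j].
  rewrite /jac (expand_det_row _ ord0); apply: eq_bigr => j _.
  rewrite mxE unlift_none /=; congr (_ * _); rewrite /cofactor; congr (_ * \det _).
  by apply/matrixP => i k; rewrite !mxE liftK.
pose v : 'cV[O]_n.+1 := \col_j (ratr (p j) *: 'X_j).
have Av i : (A f *m v) i 0 = oapp (fun k => ratr (e k) *: g k) f (unlift ord0 i).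
  rewrite mxE; under eq_bigr do rewrite !mxE mulrC.
  case: (unlift ord0 i) => [k|] /=; first exact: euler.
  by rewrite (euler f1) rmorph1 scale1r.
have : \adj (A f) *m (A f *m v) = jac g f *: v.
  by rewrite mulmxA mul_adj_mx mul_scalar_mx.
move=> /matrixP/(_ j 0); rewrite !mxE mulrC => <-.
rewrite big_ord_recl Av unlift_none mxE addrAC subrr add0r.
apply: subspace_sum (base_ideal_is_ideal g).1 _ => i _.
apply: (base_ideal_is_ideal g).2; rewrite Av liftK /=.
by apply: subspaceZ (base_ideal_is_ideal g).1 _; apply: base_ideal_mem.
Qed.

(** [f dh = deg(h) h df] on the curve [g = 0]. *)
Lemma euler_jac f h d : whomog p 1 f -> whomog p d h ->
  base_ideal g (f * jac g h - ratr d *: (h * jac g f)).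
Proof.
move=> f1 hd; have [c [jacE cP]] := euler_minors f1.
have -> : f * jac g h - ratr d *: (h * jac g f) =
    \sum_j - h^`M(j) * (ratr (p j) *: 'X_j * jac g f - c j * f).
  rewrite [jac g h]jacE scalerAl -(euler hd) mulr_sumr mulr_suml -sumrB.
  apply: eq_bigr => j _; rewrite mulrBr !mulNr opprK [RHS]addrC; congr (_ - _).
    by rewrite mulrCA [f * _]mulrC.
  by rewrite mulrA [h^`M(j) * _]mulrC.
apply: subspace_sum (base_ideal_is_ideal g).1 _ => j _.
exact: (base_ideal_is_ideal g).2.
Qed.

(** The class of [df] is annihilated by the coordinates modulo [(f, g)]. *)
Lemma jac_socle f (j : 'I_n.+1) : (forall i, 0 < p i) -> whomog p 1 f ->
  ideal_add f (base_ideal g) ('X_j * jac g f).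
Proof.
move=> p_gt0 f1; have [c [_ /(_ j) cP]] := euler_minors f1.
have pj : ratr (p j) != 0 :> K by rewrite fmorph_eq0 gt_eqF.
exists ((ratr (p j))^-1 *: c j).
have -> : 'X_j * jac g f - (ratr (p j))^-1 *: c j * f =
    (ratr (p j))^-1 *: (ratr (p j) *: 'X_j * jac g f - c j * f).
  by rewrite scalerBr -!scalerAl scalerA mulVf // scale1r.
exact: subspaceZ (base_ideal_is_ideal g).1 _.
Qed.

End Jacobian.

(** * A function that is nonconstant on all branches is not a zero divisor *)

Section PrimeOfPred.
Variables (R : comNzRingType) (S : {pred R}).
Hypotheses (S_ideal : idealr_closed S) (S_prime : prime_idealr_closed S).

Definition prime_pred of idealr_closed S & prime_idealr_closed S : {pred R} := S.

HB.instance Definition _ := isIdealr.Build R (prime_pred S_ideal S_prime) S_ideal.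
HB.instance Definition _ :=
  isPrimeIdealrClosed.Build R (prime_pred S_ideal S_prime) S_prime.

Definition prime_of_pred : prime_idealr R := prime_pred S_ideal S_prime.

End PrimeOfPred.

Section NonZeroDivisor.
Variables (K : numFieldType) (n : nat).
Local Notation O := {mpoly K[n.+1]}.
Implicit Types (I : set O) (f q : O) (g : 'I_n -> O).

(** The complement of a maximal multiplicative set that avoids [I] is a minimal
    prime. *)
Lemma minimal_prime_avoiding I q : is_ideal I -> radical_ideal I -> ~ I q ->
  exists2 P : prime_idealr O, minimal_prime I P & q \notin P.
Proof.
move=> [I_sub IM] I_rad Iq.
have IMr a x : I x -> I (x * a) by move=> Ix; rewrite mulrC; apply: IM.
pose mult (S : set O) := [/\ forall x y, S x -> S y -> S (x * y),
  forall x, S x -> ~ I x & forall x, S x -> S 1 /\ S q].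
(* The condition on 1 and q only bites for nonempty sets: the empty set makes
   the family stable under unions of the empty chain. *)
have [|A [[AM AI A1q] Amax]] := @Zorn_bigcup O mult.
  move=> F Fmult Ftot; split.
  - move=> x y [X FX Xx] [Y FY Yy].
    have [XY|YX] := Ftot _ _ FX FY.
      by exists Y => //; have [YM _ _] := Fmult _ FY; apply: YM => //; apply: XY.
    by exists X => //; have [XM _ _] := Fmult _ FX; apply: XM => //; apply: YX.
  - by move=> x [X FX Xx]; have [_ XI _] := Fmult _ FX; apply: XI.
  - by move=> x [X FX Xx]; have [_ _ X1] := Fmult _ FX; have [? ?] := X1 _ Xx;
      split; exists X.
have A1 : A 1.
  apply: contrapT => A1; have A0 x : ~ A x by move=> /A1q[].
  apply: (Amax (range (fun k => q ^+ k))); first split.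
  - by move=> x /A0.
  - by move=> /(_ (q ^+ 0)) H; apply: (A0 _ (H _)); exists 0%N.
  split.
  - by move=> _ _ [k _ <-] [l _ <-]; exists (k + l)%N => //; rewrite exprD.
  - by move=> _ [k _ <-] /I_rad.
  - by move=> _ _; split; [exists 0%N|exists 1%N].
have Aq : A q by have [] := A1q _ A1.
have AP x : ~ A x -> exists s k, A s /\ I (s * x ^+ k).
  move=> Ax; apply: contrapT => H.
  apply: (Amax [set y | exists s k, A s /\ y = s * x ^+ k]); first split.
  - by move=> y Ay; exists y, 0%N; rewrite mulr1.
  - move=> /(_ x) H'; apply: Ax; apply: H'.
    by exists 1, 1%N; rewrite mul1r.
  split.
  - move=> _ _ [s [k [As ->]]] [t [l [At ->]]]; exists (s * t), (k + l)%N.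
    by split; [apply: AM|rewrite exprD mulrACA].
  - by move=> _ [s [k [As ->]]] Isx; apply: H; exists s, k.
  - by move=> _ _; split; [exists 1, 0%N|exists q, 0%N]; rewrite mulr1.
pose S : {pred O} := fun x => ~~ `[< A x >].
have SP x : (x \in S) <-> ~ A x by rewrite unfold_in; split=> /asboolPn.
have S_ideal : idealr_closed S.
  split.
  - by apply/SP => /AI; apply; apply: I_sub.1.
  - by apply/negP => /SP.
  move=> a x y /SP Ax /SP Ay; apply/SP => Axy.
  have {Ax}[s [k [As Isx]]] := AP _ Ax; have {Ay}[t [l [At Ity]]] := AP _ Ay.
  have Apow j : A ((a * x + y) ^+ j).
    by elim: j => [|j IH]; [|rewrite exprS; apply: AM].
  apply: (AI (s * t * (a * x + y) ^+ (k + l))); first by apply: (AM) => //; apply: (AM).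
  rewrite exprDn mulr_sumr; apply: subspace_sum => // i _.
  rewrite mulrnAr -scaler_nat; apply: subspaceZ => //.
  have [li|li] := leqP l i.
    rewrite -(subnK li) exprD.
    have -> : s * t * ((a * x) ^+ (k + l - (i - l + l)) * (y ^+ (i - l) * y ^+ l)) =
      (s * (a * x) ^+ (k + l - (i - l + l)) * y ^+ (i - l)) * (t * y ^+ l) by ring.
    exact: IM.
  have -> : (k + l - i = l - i + k)%N by lia.
  rewrite exprMn [x ^+ _]exprD.
  have -> : s * t * (a ^+ (l - i + k) * (x ^+ (l - i) * x ^+ k) * y ^+ i) =
    (t * a ^+ (l - i + k) * x ^+ (l - i) * y ^+ i) * (s * x ^+ k) by ring.
  exact: IM.
have S_prime : prime_idealr_closed S.
  move=> x y /SP Axy; rewrite -[_ || _]negbK negb_or; apply/negP => /andP[Sx Sy].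
  apply: Axy; apply: (AM).
    by move: Sx; rewrite unfold_in negbK => /asboolP.
  by move: Sy; rewrite unfold_in negbK => /asboolP.
exists (prime_of_pred S_ideal S_prime); last by apply/negP => /SP.
split=> [x Ix|Q IQ QS x /SP/AP[s [k [As Isx]]]] /=; first by apply/SP => /AI.
have := IQ _ Isx; rewrite /= prime_idealrM => /orP[/QS/SP//|].
elim: (k) => [|j IH]; last by rewrite exprS prime_idealrM => /orP[].
by rewrite expr0 => /QS/SP.
Qed.

(** If [q] is not in the radical ideal [(g)], some branch avoids [q]; and [f],
    being nonconstant, does not vanish on that branch. *)
Lemma nonconstant_nonzerodivisor f g q : radical_ideal (base_ideal g) ->
  nonconstant_on_branches f g -> base_ideal g (f * q) -> base_ideal g q.
Proof.
move=> g_rad fg Ifq; apply: contrapT => Iq.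
have [P Pmin Pq] := minimal_prime_avoiding (base_ideal_is_ideal g) g_rad Iq.
have := Pmin.1 _ Ifq; rewrite /= prime_idealrM (negPf Pq) orbF.
by have := fg P Pmin 0; rewrite mpolyC0 subr0 => /negP.
Qed.

End NonZeroDivisor.

(** * The top degree of a graded complete intersection *)

Section Coordinates.
Variables (K : fieldType) (U : lmodType K) (B : set U) (I : finType) (v : I -> U).
Hypotheses (B_sub : subspace B) (vB : subquot_basis [set: U] B v).

Lemma subquot_coord : exists phi : I -> {scalar U},
  [/\ forall x, B (x - \sum_k phi k x *: v k),
      forall k x, B x -> phi k x = 0
    & forall k l, phi k (v l) = (k == l)%:R].
Proof.
have [_ span free] := vB.
have /choice[c cP] x := span x Logic.I.
have uniq x a : B (x - \sum_k a k *: v k) -> forall k, c x k = a k.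
  move=> xa k; apply/eqP; rewrite -subr_eq0; apply/eqP.
  apply: (free (fun k => c x k - a k)).
  under eq_bigr do rewrite scalerBl.
  rewrite sumrB; have -> : \sum_k c x k *: v k - \sum_k a k *: v k =
      (x - \sum_k a k *: v k) - (x - \sum_k c x k *: v k).
    by rewrite opprB [RHS]addrC addrA subrK.
  exact: subspaceB.
have lin k : scalar (c^~ k).
  move=> a x y; apply: (uniq _ (fun k => a * c x k + c y k)).
  under eq_bigr do rewrite scalerDl -scalerA.
  rewrite big_split -scaler_sumr opprD addrACA -scalerBr.
  exact: B_sub.2.
pose phi k : {scalar U} :=
  HB.pack (c^~ k) (GRing.isLinear.Build K U K _ (c^~ k) (lin k)).
exists phi.
split=> //= [k x Bx|k l].
  by rewrite (uniq _ (fun=> 0)) // big1 ?subr0 // => *; rewrite scale0r.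
rewrite (uniq _ (fun k => (k == l)%:R)) // (bigD1 l) //= eqxx scale1r big1.
  by rewrite addr0 subrr; apply: B_sub.1.
by move=> i /negPf ->; rewrite scale0r.
Qed.

End Coordinates.

Section Bezoutian.
Variables (K : numFieldType) (n : nat) (p : 'I_n.+1 -> rat).
Local Notation O := {mpoly K[n.+1]}.
(* Polynomials in two groups of variables x, y: the coefficients depend on x. *)
Local Notation O2 := {mpoly O[n.+1]}.
Implicit Types (q a : O) (P : O2) (phi : {scalar O}).

Local Notation in_x := (@mpolyC n.+1 O).
Local Notation in_y := (map_mpoly (@mpolyC n.+1 K)).
Local Notation on_diag := (meval (fun j : 'I_n.+1 => 'X_j : O)).

(** [apply_x phi] is [phi] on the x part of [O (x) O], and [apply_y phi] on the
    y part. *)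
Definition apply_x phi P : O := map_mpoly phi P.
Definition apply_y phi P : O := \sum_(m <- msupp P) phi 'X_[m] *: P@_m.

Lemma mcoeff_apply_x phi P m : (apply_x phi P)@_m = phi P@_m.
Proof. exact: mcoeff_map_mpoly. Qed.

Lemma apply_yE phi P i : (msize P <= i)%N ->
  apply_y phi P = \sum_(m : 'X_{1..n.+1 < i}) phi 'X_[m] *: P@_m.
Proof.
move=> le_pi; set I : subFinType _ := 'X_{1..n.+1 < i}.
rewrite /apply_y (big_mksub I) ?msupp_uniq //=; first last.
  by move=> x /msize_mdeg_lt /leq_trans; apply.
by rewrite big_rmcond //= => j /memN_msupp_eq0 ->; rewrite scaler0.
Qed.

Fact apply_y_additive phi : additive (apply_y phi).
Proof.
move=> P P'; pose i := maxn (msize (P - P')) (maxn (msize P) (msize P')).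
rewrite !(@apply_yE _ _ i) ?leq_max ?leqnn ?orbT // -sumrB.
by apply: eq_bigr => m _; rewrite raddfB /= scalerBr.
Qed.
HB.instance Definition _ phi := GRing.isAdditive.Build O2 O (apply_y phi)
  (apply_y_additive phi).
HB.instance Definition _ phi := GRing.isAdditive.Build O2 O (apply_x phi)
  (map_mpoly_is_additive phi).

Lemma apply_xU phi c m : apply_x phi (c *: 'X_[m]) = phi c *: 'X_[m].
Proof.
apply/mpolyP => k; rewrite mcoeff_apply_x !mcoeffZ !mcoeffX.
by case: (m == k); rewrite ?mulr1 // !mulr0 raddf0.
Qed.

Lemma apply_yU phi c m : apply_y phi (c *: 'X_[m]) = phi 'X_[m] *: c.
Proof.
have [->|c0] := eqVneq c 0; first by rewrite scale0r raddf0 scaler0.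
by rewrite /apply_y msuppMCX // big_seq1 mcoeffZ mcoeffX eqxx mulr1.
Qed.

Lemma apply_x_in_y phi a P : apply_x phi (in_y a * P) = a * apply_x phi P.
Proof.
rewrite [P]mpolyE mulr_sumr !raddf_sum mulr_sumr; apply: eq_bigr => m _ /=.
move: (P@_m) => c; rewrite [a]mpolyE rmorph_sum !mulr_suml raddf_sum.
apply: eq_bigr => k _; rewrite /= map_mpolyZ map_mpolyX apply_xU.
rewrite -scalerAl -scalerAr -mpolyXD scalerA apply_xU mul_mpolyC linearZ /=.
by rewrite -scalerAl -scalerAr -mpolyXD scalerA.
Qed.

Lemma apply_y_in_x phi a P : apply_y phi (in_x a * P) = a * apply_y phi P.
Proof.
rewrite [P]mpolyE mulr_sumr !raddf_sum mulr_sumr; apply: eq_bigr => m _ /=.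
by rewrite mul_mpolyC scalerA !apply_yU scalerAr.
Qed.

Lemma apply_y_in_y phi a c m :
  apply_y phi (in_y a * (c *: 'X_[m])) = phi (a * 'X_[m]) *: c.
Proof.
rewrite [a]mpolyE rmorph_sum !mulr_suml !raddf_sum scaler_suml.
apply: eq_bigr => k _; rewrite /= map_mpolyZ map_mpolyX.
rewrite -scalerAl -scalerAr -mpolyXD scalerA apply_yU mul_mpolyC -scalerAl.
by rewrite -mpolyXD [phi (_ *: _)]linearZ /= [LHS]scalerA mulrC.
Qed.

Variable fs : 'I_n.+1 -> O.

Definition gens_ideal : set O :=
  [set q | exists c : 'I_n.+1 -> O, q = \sum_i c i * fs i].

(** The kernel of [O (x) O -> O/(fs) (x) O/(fs)]. *)
Definition gens_ideal2 : set O2 := [set P | exists c c' : 'I_n.+1 -> O2,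
  P = \sum_i (c i * in_x (fs i) + c' i * in_y (fs i))].

Lemma gens_ideal_is_ideal : is_ideal gens_ideal.
Proof.
split; [split|].
- by exists (fun=> 0); rewrite big1 // => i _; rewrite mul0r.
- move=> c _ _ [x ->] [y ->]; exists (fun i => c *: x i + y i).
  rewrite scaler_sumr -big_split; apply: eq_bigr => i _ /=.
  by rewrite mulrDl scalerAl.
- move=> a _ [x ->]; exists (fun i => a * x i).
  by rewrite mulr_sumr; apply: eq_bigr => i _; rewrite mulrA.
Qed.

Lemma gens_ideal_mem i : gens_ideal (fs i).
Proof.
exists (fun j => (i == j)%:R); rewrite (bigD1 i) //= eqxx mul1r big1 ?addr0 //.
by move=> j; rewrite eq_sym => /negPf ->; rewrite mul0r.
Qed.

Lemma gens_ideal2_0 : gens_ideal2 0.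
Proof.
by exists (fun=> 0), (fun=> 0); rewrite big1 // => i _; rewrite !mul0r addr0.
Qed.

Lemma gens_ideal2D P P' : gens_ideal2 P -> gens_ideal2 P' -> gens_ideal2 (P + P').
Proof.
move=> [c [c' ->]] [b [b' ->]]; exists (fun i => c i + b i), (fun i => c' i + b' i).
by rewrite -big_split; apply: eq_bigr => i _; rewrite /= !mulrDl addrACA.
Qed.

Lemma gens_ideal2M P P' : gens_ideal2 P' -> gens_ideal2 (P * P').
Proof.
move=> [c [c' ->]]; exists (fun i => P * c i), (fun i => P * c' i).
by rewrite mulr_sumr; apply: eq_bigr => i _; rewrite mulrDr !mulrA.
Qed.

Lemma gens_ideal2_sum (J : Type) (r : seq J) (F : J -> O2) :
  (forall j, gens_ideal2 (F j)) -> gens_ideal2 (\sum_(j <- r) F j).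
Proof.
move=> FI; elim/big_ind: _ => //; [exact: gens_ideal2_0|exact: gens_ideal2D].
Qed.

Lemma gens_ideal2_diff i : gens_ideal2 (in_x (fs i) - in_y (fs i)).
Proof.
exists (fun j => (i == j)%:R), (fun j => - (i == j)%:R).
rewrite (bigD1 i) //= eqxx mul1r mulN1r big1 ?addr0 //.
by move=> j; rewrite eq_sym => /negPf ->; rewrite oppr0 !mul0r addr0.
Qed.

Section ApplyIdeal.
Variable phi : {scalar O}.
Hypothesis phi0 : forall q, gens_ideal q -> phi q = 0.

Lemma phi_gens i a : phi (a * fs i) = 0.
Proof. by apply: phi0; apply: gens_ideal_is_ideal.2; apply: gens_ideal_mem. Qed.

Lemma apply_x_ideal P : gens_ideal2 P -> gens_ideal (apply_x phi P).
Proof.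
move=> [c [c' ->]]; rewrite raddf_sum.
apply: subspace_sum gens_ideal_is_ideal.1 _ => i _; rewrite raddfD /=.
have -> : apply_x phi (c i * in_x (fs i)) = 0.
  apply/mpolyP => m; rewrite mcoeff_apply_x mcoeff0.
  by rewrite mulrC mcoeffCM mulrC phi_gens.
rewrite add0r mulrC apply_x_in_y mulrC.
by apply: gens_ideal_is_ideal.2; apply: gens_ideal_mem.
Qed.

Lemma apply_y_ideal P : gens_ideal2 P -> gens_ideal (apply_y phi P).
Proof.
move=> [c [c' ->]]; rewrite raddf_sum.
apply: subspace_sum gens_ideal_is_ideal.1 _ => i _; rewrite raddfD /=.
have -> : apply_y phi (c' i * in_y (fs i)) = 0.
  rewrite [c' i]mpolyE mulr_suml raddf_sum big1 // => m _ /=.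
  by rewrite mulrC apply_y_in_y mulrC phi_gens scale0r.
rewrite addr0 mulrC apply_y_in_x mulrC.
by apply: gens_ideal_is_ideal.2; apply: gens_ideal_mem.
Qed.

End ApplyIdeal.

Definition ydeg_le (d : rat) P : Prop := forall m, P@_m != 0 -> weight p m <= d.

Lemma ydeg_le0 d : ydeg_le d 0.
Proof. by move=> m; rewrite mcoeff0 eqxx. Qed.

Lemma ydeg_leD d P P' : ydeg_le d P -> ydeg_le d P' -> ydeg_le d (P + P').
Proof.
move=> dP dP' m; rewrite mcoeffD.
have [/eqP P0|/dP//] := boolP (P@_m == 0); by rewrite P0 add0r => /dP'.
Qed.

Lemma ydeg_leN d P : ydeg_le d P -> ydeg_le d (- P).
Proof. by move=> dP m; rewrite mcoeffN oppr_eq0 => /dP. Qed.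

Lemma ydeg_leM d d' P P' : ydeg_le d P -> ydeg_le d' P' -> ydeg_le (d + d') (P * P').
Proof.
move=> dP dP' m; rewrite -mcoeff_msupp => /msuppM_le/allpairsP[[m1 m2] /= [+ + ->]].
by rewrite !mcoeff_msupp weightD => /dP ? /dP' ?; apply: lerD.
Qed.

Lemma ydeg_le_mono d d' P : d <= d' -> ydeg_le d P -> ydeg_le d' P.
Proof. by move=> dd' dP m /dP /le_trans; apply. Qed.

Lemma ydeg_le_in_x q : ydeg_le 0 (in_x q).
Proof.
by move=> m; rewrite mcoeffC; case: (m =P 0%MM) => [->|_];
  rewrite ?weight0 ?mulr0 ?eqxx.
Qed.

Lemma ydeg_le_in_y d q : whomog p d q -> ydeg_le d (in_y q).
Proof.
move=> /whomogP qd m; rewrite mcoeff_map_mpoly /= mpolyC_eq0 => /qd ->.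
exact: lexx.
Qed.

Lemma in_yE q : in_y q = \sum_(m <- msupp q) in_x (q@_m)%:MP * in_y 'X_[m].
Proof.
rewrite {1}/map_mpoly /mmap; apply: eq_bigr => m _ /=.
by rewrite mmap1_id map_mpolyX.
Qed.

Lemma in_xE q : in_x q = \sum_(m <- msupp q) in_x (q@_m)%:MP * in_x 'X_[m].
Proof.
rewrite {1}[q]mpolyE raddf_sum; apply: eq_bigr => m _ /=.
by rewrite -mpolyCM mul_mpolyC.
Qed.

Lemma on_diag_in_y q : on_diag (in_y q) = q.
Proof.
rewrite [in RHS](mpolyE q) /map_mpoly /mmap rmorph_sum; apply: eq_bigr => m _ /=.
by rewrite rmorphM /= mevalC mmap1_id mevalX -mpolyXE_id mul_mpolyC.
Qed.

(** The ideal of the diagonal is generated by the [x_j - y_j], and the classes of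
    its elements modulo its square are their differentials. *)
Definition bezout_coef q (b : 'I_n.+1 -> O2) : Prop :=
  in_x q - in_y q = \sum_j b j * (in_x 'X_j - in_y 'X_j) /\
  forall j, on_diag (b j) = q^`M(j).

Hypothesis p_gt0 : forall i, 0 < p i.

Lemma bezout_coefX m : exists2 b, bezout_coef 'X_[m] b &
  forall j, ydeg_le (weight p m - p j) (b j).
Proof.
move: {2}(mdeg m) (leqnn (mdeg m)) => k; elim: k m => [|k IH] m mk.
  have /eqP -> : m == 0%MM by rewrite -mdeg_eq0 -leqn0.
  exists (fun=> 0) => [|j]; last exact: ydeg_le0.
  rewrite mpolyX0; split=> [|j]; last by rewrite raddf0 -mpolyC1 mderivC.
  by rewrite !rmorph1 subrr big1 // => j _; rewrite mul0r.
have [->|m0] := eqVneq m 0%MM; first by apply: IH; rewrite mdeg0.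
have [i mi] := mnm_neq0_gt0 m0; pose m' := (m - U_(i))%MM.
have mE : m = (U_(i) + m')%MM by rewrite mnm_subUK.
have [|b [bE bd] by_le] := IH m'.
  by rewrite mE mdegD mdeg1 in mk.
(* x_i x^m' - y_i y^m' = x_i (x^m' - y^m') + y^m' (x_i - y_i) *)
exists (fun j => in_x 'X_i * b j + (i == j)%:R * in_y 'X_[m']); last first.
  move=> j; apply: ydeg_leD.
    apply: (@ydeg_le_mono (0 + (weight p m' - p j))).
      by rewrite mE weightD weightU add0r lerD2r lerDr ltW.
    exact: ydeg_leM (@ydeg_le_in_x _) (by_le j).
  case: eqP => [<-|_]; last by rewrite mul0r; apply: ydeg_le0.
  rewrite mul1r mE weightD weightU addrAC subrr add0r.
  by apply: ydeg_le_in_y; apply: whomogX.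
rewrite mE mpolyXD; split=> [|j].
  under eq_bigr do rewrite mulrDl.
  rewrite big_split /= [X in _ = _ + X](bigD1 i) //= [X in _ = _ + (_ + X)]big1.
    rewrite eqxx mul1r addr0; under eq_bigr do rewrite -mulrA.
    rewrite -mulr_sumr -bE !rmorphM /=.
    move: (in_x 'X_i) (in_y 'X_i) (in_x 'X_[m']) (in_y 'X_[m']) => x y u w.
    by rewrite !mulrBr [w * x]mulrC [w * y]mulrC addrA subrK.
  by move=> j; rewrite eq_sym => /negPf ->; rewrite !mul0r.
rewrite rmorphD !rmorphM /= rmorph_nat bd on_diag_in_y mevalC mderivM.
rewrite [('X_i)^`M(j)]mderivX mnm1E.
rewrite addrC; congr (_ + _); case: eqP => [<-|_]; last by rewrite scale0r !mul0r.
have -> : (U_(i) - U_(i))%MM = 0%MM.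
  by apply/mnmP => l; rewrite mnmBE subnn mnm0E.
by rewrite mpolyX0 scale1r.
Qed.

Lemma bezout_coef_homog d q : whomog p d q ->
  exists2 b, bezout_coef q b & forall j, ydeg_le (d - p j) (b j).
Proof.
move=> qd; have /choice[B BP] m : exists b, bezout_coef 'X_[m] b /\
    forall j, ydeg_le (weight p m - p j) (b j).
  by have [b ? ?] := bezout_coefX m; exists b.
exists (fun j => \sum_(m <- msupp q) in_x (q@_m)%:MP * B m j).
  split=> [|j].
    under [RHS]eq_bigr do rewrite mulr_suml.
    rewrite exchange_big in_xE in_yE -sumrB; apply: eq_bigr => m _ /=.
    rewrite -mulrBr (BP m).1.1 mulr_sumr.
    by apply: eq_bigr => j _; rewrite mulrA.
  rewrite [in RHS](mpolyE q) !raddf_sum; apply: eq_bigr => m _ /=.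
  by rewrite rmorphM /= mevalC (BP m).1.2 mderivZ mul_mpolyC.
move=> j; rewrite big_seq; elim/big_ind: _ => [||m /qd <-]; first exact: ydeg_le0.
  by move=> *; apply: ydeg_leD.
by rewrite -[_ - _]add0r; apply: ydeg_leM (@ydeg_le_in_x _) ((BP m).2 j).
Qed.

End Bezoutian.

Section TopDegree.
Variables (K : numFieldType) (n : nat) (p : 'I_n.+1 -> rat).
Local Notation O := {mpoly K[n.+1]}.
Local Notation O2 := {mpoly O[n.+1]}.
Local Notation in_x := (@mpolyC n.+1 O).
Local Notation in_y := (map_mpoly (@mpolyC n.+1 K)).
Local Notation on_diag := (meval (fun j : 'I_n.+1 => 'X_j : O)).
Hypothesis p_gt0 : forall i, 0 < p i.
Variables (fs : 'I_n.+1 -> O) (d : 'I_n.+1 -> rat).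
Hypothesis fs_homog : forall i, whomog p (d i) (fs i).

Local Notation I := (gens_ideal fs).
Local Notation I2 := (gens_ideal2 fs).
Local Notation J := (\det (\matrix_(i, j) (fs i)^`M(j))).
Local Notation delta := (\sum_i d i - \sum_j p j).

(** The Bezoutian: the determinant [D] of the matrix of Bezout coefficients.
    By Cramer's rule it is annihilated by the diagonal ideal, modulo the [fs] in
    [x] and in [y]; on the diagonal it restricts to the Jacobian determinant. *)
Lemma bezoutian : exists D : O2, [/\ on_diag D = J, ydeg_le p delta D
  & forall a, I2 ((in_x a - in_y a) * D)].
Proof.
have /choice[B BP] i : exists b, bezout_coef (fs i) b /\
    forall j, ydeg_le p (d i - p j) (b j).
  by have [b ? ?] := bezout_coef_homog p_gt0 (@fs_homog i); exists b.
pose A : 'M[O2]_n.+1 := \matrix_(i, j) B i j.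
pose v : 'cV[O2]_n.+1 := \col_j (in_x 'X_j - in_y 'X_j).
have Dv j : I2 ((in_x 'X_j - in_y 'X_j) * \det A).
  have : \adj A *m (A *m v) = \det A *: v by rewrite mulmxA mul_adj_mx mul_scalar_mx.
  move=> /matrixP/(_ j 0); rewrite !mxE mulrC => <-.
  apply: gens_ideal2_sum => i; apply: gens_ideal2M; rewrite mxE.
  under eq_bigr do rewrite !mxE.
  by rewrite -(BP i).1.1; apply: gens_ideal2_diff.
exists (\det A); split.
- rewrite -det_map_mx; congr (\det _); apply/matrixP => i j.
  by rewrite !mxE; apply: (BP i).1.2.
- apply: graded_det.
  + exact: ydeg_le0.
  + by move=> *; apply: ydeg_leD.
  + by move=> *; apply: ydeg_leN.
  + by rewrite -mpolyC1; apply: ydeg_le_in_x.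
  + by move=> *; apply: ydeg_leM.
  by move=> i j; rewrite mxE; apply: (BP i).2.
have X m : I2 ((in_x 'X_[m] - in_y 'X_[m]) * \det A).
  have [b [bE _] _] := bezout_coefX K p_gt0 m.
  rewrite bE mulr_suml; apply: gens_ideal2_sum => j.
  by rewrite -mulrA; apply: gens_ideal2M.
move=> a; rewrite in_xE in_yE -sumrB mulr_suml; apply: gens_ideal2_sum => m.
by rewrite -mulrBr -mulrA; apply: gens_ideal2M.
Qed.

Lemma gens_ideal_wfilter P q : I q -> I (wfilter p P q).
Proof.
move=> [c ->]; exists (fun i => wfilter p (fun r => P (r + d i)) (c i)).
by rewrite linear_sum; apply: eq_bigr => i _; rewrite /= (wfilterM _ _ (@fs_homog i)).
Qed.

Variables (B : finType) (v : B -> O) (dv : B -> rat).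
Hypothesis v_homog : forall k, whomog p (dv k) (v k).
Hypothesis v_basis : subquot_basis [set: O] I v.

Lemma coord_whomog (phi : B -> {scalar O}) :
  (forall x, I (x - \sum_k phi k x *: v k)) ->
  forall k q c, whomog p c q -> c != dv k -> phi k q = 0.
Proof.
move=> phiP k q c qc ck; have [_ _ free] := v_basis.
have := gens_ideal_wfilter (pred1 (dv k)) (phiP q).
rewrite linearB /= (wfilter_whomog _ qc) /= (negPf ck) sub0r.
rewrite [wfilter _ _ _]linear_sum /=.
rewrite (eq_bigr (fun l => phi l q *: (if dv l == dv k then v l else 0))); last first.
  by move=> l _; rewrite [wfilter _ _ _]linearZ /= (wfilter_whomog _ (@v_homog l)).
move=> /(subspaceZ (-1) (gens_ideal_is_ideal fs).1); rewrite scaleN1r opprK => H.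
have := free (fun l => if dv l == dv k then phi l q else 0) _ k.
rewrite eqxx; apply; move: H; congr (I _); apply: eq_bigr => l _.
by case: ifP => _; rewrite ?scale0r ?scaler0.
Qed.

(** Write [D = sum_m u_m y^m], and let [phi_k] be the coordinates with respect to
    the homogeneous basis [v] of [O/I]. Modulo [I], the determinant [J], which is
    the restriction of [D] to the diagonal, is

      [sum_m u_m x^m = sum_(m, k) u_m phi_k(x^m) v_k
                     = sum_m u_m (sum_k phi_k(x^m v_k)) = dim(O/I) u_0],

    since [D] is annihilated by [v_k(x) - v_k(y)], and since the multiplication by
    [x^m] on [O/I] has trace [0] unless [m = 0]. Hence, [J] being nonzero in
    [O/I], some [phi_k(u_0)] is nonzero. Then [z = sum_m phi_k(u_m) y^m] has a
    nonzero constant term, while [q z = sum_m phi_k(q u_m) y^m] modulo [I] has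
    degree at most [delta]. If [deg q > delta], its component of degree [deg q]
    gives that [q] vanishes in [O/I]. *)
Lemma top_degree c q : ~ I J -> whomog p c q -> delta < c -> I q.
Proof.
move=> IJ qc cd; have [I_sub IM] := gens_ideal_is_ideal fs.
have [phi [phiP phi0 phiv]] := subquot_coord I_sub v_basis.
have [D [DJ Dle DI]] := bezoutian.
have [k phik] : exists k, phi k D@_0 <> 0.
  apply: contrapT => /forallNP phiD; apply: IJ.
  have ID0 : I D@_0.
    have := phiP D@_0; rewrite big1 ?subr0 // => k _.
    by have /contrapT -> := phiD k; rewrite scale0r.
  have I1 : I (J - \sum_k v k * apply_y (phi k) D).
    rewrite -DJ mevalE.
    rewrite [\sum_k _](eq_bigr (fun k =>
      \sum_(m <- msupp D) D@_m * (phi k 'X_[m] *: v k))).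
      rewrite exchange_big -sumrB; apply: subspace_sum => // m _ /=.
      by rewrite -mpolyXE_id -mulr_sumr -mulrBr; apply: IM.
    move=> k _; rewrite /apply_y mulr_sumr; apply: eq_bigr => m _.
    by rewrite -scalerAr -[RHS]scalerAr mulrC.
  have I2' : I (\sum_k v k * apply_y (phi k) D -
      \sum_k apply_y (phi k) (in_y (v k) * D)).
    rewrite -sumrB; apply: subspace_sum => // k _.
    rewrite -apply_y_in_x -raddfB -mulrBl.
    by apply: apply_y_ideal (DI _) => a; apply: phi0.
  have I3 : \sum_k apply_y (phi k) (in_y (v k) * D) = #|B|%:R *: D@_0.
    suff H l : apply_y (phi l) (in_y (v l) * D) = D@_0.
      by under eq_bigr do rewrite H; rewrite sumr_const scaler_nat.
    have -> : apply_y (phi l) (in_y (v l) * D) =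
        \sum_(m <- msupp D) phi l (v l * 'X_[m]) *: D@_m.
      rewrite {1}[D]mpolyE mulr_sumr raddf_sum; apply: eq_bigr => m _.
      exact: apply_y_in_y.
    have H0 m : m != 0%MM -> phi l (v l * 'X_[m]) *: D@_m = 0.
      move=> /(weight_gt0 p_gt0) m0.
      rewrite (coord_whomog phiP (c := dv l + weight p m)) ?scale0r //.
        exact: whomogM (@v_homog l) (@whomogX _ _ _ m).
      by rewrite -subr_eq0 addrAC subrr add0r gt_eqF.
    have [D0|/memN_msupp_eq0 D0] := boolP (0%MM \in msupp D).
      rewrite (bigD1_seq 0%MM) ?msupp_uniq //= big1 // mpolyX0 mulr1 phiv eqxx.
      by rewrite scale1r addr0.
    rewrite D0 big1 // => m _; have [->|/H0//] := eqVneq m 0%MM.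
    by rewrite D0 scaler0.
  rewrite -[J](subrK (\sum_k v k * apply_y (phi k) D)).
  apply: subspaceD => //.
  rewrite -[\sum_k _](subrK (\sum_k apply_y (phi k) (in_y (v k) * D))).
  by apply: subspaceD => //; rewrite I3; apply: subspaceZ.
pose z := apply_x (phi k) D.
have Iz : I (q * z - apply_x (phi k) (in_x q * D)).
  rewrite -apply_x_in_y -raddfB -mulrBl -opprB mulNr raddfN -scaleN1r.
  apply: subspaceZ => //; apply: apply_x_ideal (DI _) => a; exact: phi0.
have := gens_ideal_wfilter (pred1 c) Iz.
rewrite linearB /= mulrC (wfilterM _ _ qc).
have -> : wfilter p (pred1 c) (apply_x (phi k) (in_x q * D)) = 0.
  apply: wfilter_eq0 => m; rewrite mcoeff_msupp mcoeff_apply_x mcoeffCM.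
  apply: contraNN => /= /eqP mc.
  have [/eqP ->|/Dle] := boolP (D@_m == 0); first by rewrite mulr0 raddf0.
  by rewrite mc leNgt cd.
have -> : wfilter p (fun r => pred1 c (r + c)) z = (phi k D@_0)%:MP.
  apply/mpolyP => m; rewrite mcoeff_wfilter mcoeffC mcoeff_apply_x /=.
  have [->|m0] := eqVneq m 0%MM; first by rewrite weight0 add0r eqxx mulr1.
  by rewrite -subr_eq0 addrK gt_eqF ?mulr0 // weight_gt0.
rewrite subr0 mul_mpolyC => /(subspaceZ (phi k D@_0)^-1 I_sub).
by rewrite scalerA mulVf ?scale1r //; apply/eqP.
Qed.

End TopDegree.

(** * Degrees in a Jordan basis *)

Section JordanBasis.
Variables (K : numFieldType) (n : nat) (p : 'I_n.+1 -> rat).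
Local Notation O := {mpoly K[n.+1]}.
Hypothesis p_gt0 : forall i, 0 < p i.
Variables (g : 'I_n -> O) (e : 'I_n -> rat) (f : O).
Hypothesis g_homog : forall i, whomog p (e i) (g i).
Hypothesis f_homog : whomog p 1 f.
Local Notation I := (base_ideal g).
Local Notation J := (jac g f).
Local Notation A := (ideal_add J I).
Local Notation Q := (ideal_add f I).
Hypothesis f_nzd : forall q, I (f * q) -> I q.
Variables (mu2 : nat) (h : 'I_mu2 -> O) (N : 'I_mu2 -> nat).
Hypothesis h_Jordan : Jordan_basis p f g h N.
Local Notation idx := {i : 'I_mu2 & 'I_(N i).+1}.
Local Notation om i j := (omega f (h i) j).
Local Notation jidx j := (Tagged (fun i => 'I_(N i).+1) j).
Local Notation jidx0 i := (jidx (ord0 : 'I_(N i).+1)).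
Local Notation om_ k := (om (tag k) (tagged k)).

Lemma omega0 i : om i 0%N = h i.
Proof. by rewrite /omega expr0 mul1r. Qed.

Lemma omegaS i j : om i j.+1 = - f * om i j.
Proof. by rewrite /omega exprS mulrA. Qed.

Let I_ideal := base_ideal_is_ideal g.
Let A_ideal : is_ideal A := ideal_add_is_ideal J I_ideal.
Let Q_ideal : is_ideal Q := ideal_add_is_ideal f I_ideal.

Lemma omega_gtN i j : (N i < j)%N -> A (om i j).
Proof.
elim: j => // j IH; rewrite ltnS leq_eqVlt omegaS => /orP[/eqP <-|/IH Aj].
  rewrite mulNr -scaleN1r; apply: subspaceZ A_ideal.1 _.
  exact: Jordan_end h_Jordan i.
exact: A_ideal.2.
Qed.

(** The coordinate on [h i] only sees the generators of the Jordan blocks, so it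
    vanishes on multiples of [f]. *)
Lemma omega_coord : exists phi : idx -> {scalar O},
  [/\ forall x, A (x - \sum_k phi k x *: om_ k),
      forall k x, A x -> phi k x = 0,
      forall k l : idx, phi k (om_ l) = (k == l)%:R
    & forall i x, Q x -> phi (jidx0 i) x = 0].
Proof.
have [phi [phiP phiA phiE]] := subquot_coord A_ideal.1 (Jordan_basis_of h_Jordan).
exists phi; split=> // i y [x yx]; set k := jidx0 i.
rewrite -[y](subrK (x * f)) linearD /= (phiA _ _ (ideal_addl _ I_ideal yx)) add0r mulrC.
have := phiA k _ (A_ideal.2 f _ (phiP x)).
rewrite mulrBr linearB /= mulr_sumr linear_sum /= big1 => [|l _].
  by rewrite subr0.
rewrite -scalerAr [LHS]linearZ /=; case: l => i' j' /=.
have -> : f * om i' j' = - om i' j'.+1 by rewrite omegaS mulNr opprK.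
rewrite linearN /=; have [lN|Nl] := leqP j'.+1 (N i'); last first.
  by rewrite (phiA _ (om i' j'.+1)) ?oppr0 ?mulr0 //; apply: omega_gtN.
have /= -> := phiE k (jidx (Ordinal (lN : (j'.+1 < (N i').+1)%N))).
case: eqP => [kl|_]; last by rewrite oppr0 mulr0.
by have := congr1 (fun k : idx => nat_of_ord (tagged k)) kl.
Qed.

Lemma omega_notin (k : idx) : ~ A (om_ k).
Proof.
have [phi [_ phiA phiE _]] := omega_coord => /(phiA k)/eqP.
by rewrite phiE eqxx oner_eq0.
Qed.

Lemma omega_heads (a : idx -> K) :
  Q (\sum_k a k *: om_ k - \sum_i a (jidx0 i) *: h i).
Proof.
have -> : \sum_k a k *: om_ k = \sum_i \sum_(j < (N i).+1) a (jidx j) *: om i j.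
  by rewrite sig_big_dep; apply: eq_bigr => -[].
rewrite -sumrB; apply: subspace_sum Q_ideal.1 _ => i _.
rewrite big_ord_recl omega0 addrAC subrr add0r.
apply: subspace_sum Q_ideal.1 _ => j _; apply: subspaceZ Q_ideal.1 _.
by rewrite omegaS mulrC mulrN -mulNr; apply: ideal_addr.
Qed.

(** Otherwise the [mu2] elements [h i] would be a basis of [O/(f, g)], of
    dimension [mu2 + 1]. *)
Lemma jac_notin : ~ Q J.
Proof.
move=> QJ; have [phi [phiP phiA phiE phiQ]] := omega_coord.
have IQ x : I x -> Q x by apply: ideal_addl.
have AQ x : A x -> Q x.
  move=> [c xc]; rewrite -[x](subrK (c * J)); apply: subspaceD Q_ideal.1 (IQ _ xc) _.
  exact: Q_ideal.2.
suff /subquot_basis_dim : subquot_basis [set: O] Q h.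
  rewrite card_ord => /(subquot_dim_uniq Q_ideal.1)/(_ (Jordan_mu2 h_Jordan)).
  by rewrite addn1 => /n_Sn.
split=> // [x _|c cQ i].
  exists (fun i => phi (jidx0 i) x).
  rewrite [X in Q X](_ : _ = (x - \sum_k phi k x *: om_ k) +
    (\sum_k phi k x *: om_ k - \sum_i phi (jidx0 i) x *: h i)); last first.
    by rewrite addrA subrK.
  apply: subspaceD Q_ideal.1 (AQ _ (phiP x)) _.
  exact: (omega_heads (fun k => phi k x)).
rewrite -(phiQ i _ cQ) linear_sum /= (bigD1 i) //= big1 => [|l li].
  by rewrite addr0 linearZ /= -(omega0 i) (phiE _ (jidx0 i)) eqxx mulr1.
rewrite linearZ /= -(omega0 l) (phiE _ (jidx0 l)).
case: eqP => [il|_]; last by rewrite mulr0.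
by case/eqP: li; apply: esym (congr1 (fun k : idx => tag k) il).
Qed.

Lemma h_homog i : whomog p (wdeg p (h i)) (h i).
Proof.
have [d hd] := Jordan_homog h_Jordan i; rewrite (whomog_wdeg hd) //.
apply/eqP => h0; apply: (@omega_notin (jidx0 i)).
by rewrite /= omega0 h0; apply: A_ideal.1.1.
Qed.

Lemma omega_homog i j : whomog p (wdeg p (h i) + j%:R) (om i j).
Proof. by apply: whomogMX (@h_homog i) _; apply: whomogN. Qed.

Lemma nu_omega i (j : 'I_(N i).+1) : nu p e (om i j) = nu p e (h i) + j%:R.
Proof.
rewrite /nu (whomog_wdeg (@omega_homog i j)); first by ring.
apply/eqP => om0; apply: (@omega_notin (jidx j)).
by rewrite /= om0; apply: A_ideal.1.1.
Qed.

Lemma jac_mul_const c : Q ((c - (c@_0)%:MP) * J).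
Proof.
have [QS QM] := Q_ideal.
have XJ m : m != 0%MM -> Q ('X_[m] * J).
  move=> /mnm_neq0_gt0[i mi]; rewrite -(mnm_subUK mi) mpolyXD mulrAC mulrC.
  by apply: QM; apply: (jac_socle g_homog).
have -> : c - (c@_0)%:MP = \sum_(m <- msupp c | m != 0%MM) c@_m *: 'X_[m].
  have [c0|/memN_msupp_eq0 c0] := boolP (0%MM \in msupp c).
    rewrite {1}[c]mpolyE (bigD1_seq 0%MM) ?msupp_uniq //= mpolyX0.
    by rewrite -mul_mpolyC mulr1 addrAC subrr add0r.
  rewrite c0 subr0 {1}[c]mpolyE [LHS](bigID (fun m => m != 0%MM)) /=.
  rewrite [X in _ + X]big1 ?addr0 // => m; rewrite negbK => /eqP ->.
  by rewrite c0 scale0r.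
rewrite mulr_suml -big_filter; apply: subspace_sum => // m.
by rewrite mem_filter -scalerAl => /andP[/XJ Qm _]; apply: subspaceZ.
Qed.

(** The classes of the [h i] and of [J] form a homogeneous basis of [O/(f, g)],
    where no degree exceeds that of [J], and [nu (df) = 1]. *)
Lemma nu_h_le1 i : nu p e (h i) <= 1.
Proof.
have [phi [phiP phiA phiE phiQ]] := omega_coord.
pose fs k : O := oapp g f (unlift ord0 k); pose d k : rat := oapp e 1 (unlift ord0 k).
have fs_homog k : whomog p (d k) (fs k) by rewrite /fs /d; case: unlift => [l|] /=.
have QE q : gens_ideal fs q <-> Q q.
  split=> [[c ->]|[c [c' cE]]].
    exists (c ord0); rewrite big_ord_recl {1}/fs unlift_none addrAC subrr add0r.
    by exists (fun l => c (lift ord0 l)); apply: eq_bigr => l _; rewrite /fs liftK.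
  exists (fun k => oapp c' c (unlift ord0 k)).
  rewrite big_ord_recl /fs unlift_none /=; under eq_bigr do rewrite liftK.
  by rewrite -cE addrC subrK.
have QI : gens_ideal fs = Q.
  by rewrite eqEsubset; split=> q /QE.
have IQ x : I x -> Q x by apply: ideal_addl.
pose v (k : option 'I_mu2) : O := oapp h J k.
pose dv (k : option 'I_mu2) : rat :=
  oapp (fun k => wdeg p (h k)) (1 + \sum_i e i - \sum_i p i) k.
have v_homog k : whomog p (dv k) (v k).
  by case: k => [k|] /=; [apply: h_homog|apply: jac_homog].
have v_basis : subquot_basis [set: O] (gens_ideal fs) v.
  rewrite QI; split=> // [x _|c cQ].
    have [c xc] := phiP x.
    exists (oapp (fun k => phi (jidx0 k) x) (c@_0)).
    rewrite [X in Q X](_ : _ = (x - \sum_k phi k x *: om_ k - c * J) +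
      (\sum_k phi k x *: om_ k - \sum_i phi (jidx0 i) x *: h i) +
      (c - (c@_0)%:MP) * J); last first.
      rewrite (bigD1 None) //= (reindex_omap Some id) /=; last by case.
      under [X in _ - (_ + X)]eq_bigl do rewrite eqxx.
      rewrite mulrBl mul_mpolyC.
      move: (\sum_k _) (\sum_(_ < _) _) (c * J) (_ *: J) => S T C z.
      by ring.
    apply: subspaceD Q_ideal.1 _ _; last exact: jac_mul_const.
    apply: subspaceD Q_ideal.1 _ _; first exact: IQ.
    exact: (omega_heads (fun k => phi k x)).
  have c0 k : c (Some k) = 0.
    rewrite -(phiQ k _ cQ) linear_sum /= (bigD1 (Some k)) //= big1 => [|[l|] lk].
    - by rewrite addr0 linearZ /= -(omega0 k) (phiE _ (jidx0 k)) eqxx mulr1.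
    - rewrite linearZ /= -(omega0 l) (phiE _ (jidx0 l)).
      case: eqP => [kl|_]; last by rewrite mulr0.
      case/eqP: lk; congr Some.
      exact: esym (congr1 (fun k : idx => tag k) kl).
    - rewrite linearZ /= phiA ?mulr0 //.
      by have := ideal_addr J 1 I_ideal; rewrite mul1r.
  case=> [k|]; first exact: c0.
  apply: contrapT => cN; apply: jac_notin.
  move: cQ; rewrite (bigD1 None) //= big1 => [|[l _|//]]; last by rewrite c0 scale0r.
  rewrite addr0 => /(subspaceZ (c None)^-1 Q_ideal.1).
  by rewrite scalerA mulVf ?scale1r //; apply/eqP.
have sumd : \sum_k d k = 1 + \sum_i e i.
  rewrite big_ord_recl /d unlift_none; congr (_ + _); apply: eq_bigr => l _.
  by rewrite liftK.
rewrite leNgt; apply/negP => hi.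
have /QE : gens_ideal fs (h i).
  apply: (top_degree p_gt0 fs_homog v_homog v_basis _ (@h_homog i)).
    by move=> /QE; apply: jac_notin.
  by rewrite sumd; move: hi; rewrite /nu; lra.
move=> /(phiQ i)/eqP; rewrite -(omega0 i) (phiE _ (jidx0 i)) eqxx.
by rewrite oner_eq0.
Qed.

(** A power of [f], which is not a zero divisor, is a multiple of [J]. *)
Lemma jac_nzd u : I (u * J) -> I u.
Proof.
move=> IuJ; pose M := (\max_i N i).+1.
have AM : A ((- f) ^+ M).
  have [_ span _] := Jordan_basis_of h_Jordan.
  have [c cP] := span 1 Logic.I.
  have := A_ideal.2 ((- f) ^+ M) _ cP; rewrite mulrBr mulr1 => cP'.
  rewrite -[_ ^+ M](subrK ((- f) ^+ M * \sum_k c k *: om_ k)).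
  apply: subspaceD A_ideal.1 cP' _; rewrite mulr_sumr.
  apply: subspace_sum A_ideal.1 _ => -[i j] _ /=.
  rewrite -scalerAr; apply: subspaceZ A_ideal.1 _.
  rewrite /omega mulrA -exprD; apply: omega_gtN.
  by rewrite /M addSn ltnS (leq_trans (leq_bigmax i)) // leq_addr.
have [c cM] := AM; have {cM}cM := I_ideal.2 u _ cM.
have IfM : I (u * (- f) ^+ M).
  rewrite -[u * _](subrK (u * (c * J))) -mulrBr.
  by apply: subspaceD I_ideal.1 cM _; rewrite mulrCA; apply: I_ideal.2.
elim: (M) IfM => [|k IH]; first by rewrite expr0 mulr1.
rewrite exprS mulNr mulrN mulrCA -scaleN1r.
move=> /(subspaceZ (-1) I_ideal.1); rewrite scalerA mulrNN mulr1 scale1r.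
by move=> /f_nzd.
Qed.

(** [f omega = u df] forces [nu omega >= 0] and [du = nu omega * omega], since
    [u] is a polynomial of degree [nu omega] with [f du = deg(u) u df]. *)
Lemma omega_last i : exists u, [/\ I (f * om i (N i) - u * J),
  I (jac g u - ratr (nu p e (om i (N i))) *: om i (N i)) & 0 <= nu p e (om i (N i))].
Proof.
have nuE : nu p e (om i (N i)) = nu p e (h i) + (N i)%:R.
  by have := @nu_omega i ord_max.
have [c cP] := Jordan_end h_Jordan i.
pose D := 1 + (wdeg p (h i) + (N i)%:R).
pose dJ := 1 + \sum_i e i - \sum_i p i.
have J_homog : whomog p dJ J by apply: jac_homog.
pose u := wfilter p (fun r => pred1 D (r + dJ)) c.
have nuD : nu p e (om i (N i)) = D - dJ by rewrite nuE /nu /D /dJ; ring.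
have u_homog : whomog p (D - dJ) u.
  apply/whomogP => m; rewrite mcoeff_wfilter /=.
  by case: (_ + _ =P D) => [<- _|_]; rewrite ?addrK ?eqxx.
have Iu : I (f * om i (N i) - u * J).
  have := base_ideal_wfilter (pred1 D) g_homog cP.
  rewrite linearB /= (wfilterM _ _ J_homog) (@wfilter_id _ _ _ _ (f * _)) // => m.
  by move=> /(whomogM f_homog (@omega_homog i (N i))) -> /=.
exists u; split=> //.
  apply: f_nzd; rewrite mulrBr -scalerAr nuD.
  rewrite -[f * jac g u](subrK (ratr (D - dJ) *: (u * J))) -addrA -scalerBr.
  apply: subspaceD I_ideal.1 (euler_jac g_homog f_homog u_homog) _.
  apply: subspaceZ I_ideal.1 _; rewrite -opprB -scaleN1r.
  exact: subspaceZ I_ideal.1 _.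
rewrite nuD; apply: (whomog_ge0 p_gt0 u_homog); apply/eqP => u0.
apply: (@omega_notin (jidx (ord_max : 'I_(N i).+1))); apply: ideal_addl => //=.
by apply: f_nzd; move: Iu; rewrite u0 mul0r subr0.
Qed.

End JordanBasis.

(** * The Gauss-Manin system of the curve *)

Lemma lcoef_bounded (K : fieldType) (n : nat) (y : laurent K n) :
  exists M : int, forall k, lcoef y k != 0 -> k < M.
Proof.
pose s := finmap.enum_fset (lsupp y); exists (\sum_(k <- s) `|k| + 1) => k.
rewrite /lcoef monalg.mcoeff_neq0 => ky; rewrite (big_rem k) //=.
by rewrite ltzD1 (le_trans (ler_norm k)) // lerDl sumr_ge0.
Qed.

Section GaussManin0.
Variables (K : numFieldType) (n : nat).
Variables (f : {mpoly K[n.+1]}) (g : 'I_n -> {mpoly K[n.+1]}).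
Local Notation O := {mpoly K[n.+1]}.
Local Notation L := (laurent K n).
Local Notation GM := (GaussManin f g).
Local Notation GM0 := (GaussManin0 f g).
Local Notation I := (base_ideal g).
Local Notation J := (jac g f).
Implicit Types (q a : O) (x y : L) (m k : int).

Fact gm0_tau_linear j : linear (gm0_tau f g j).
Proof.
move=> a x y; rewrite -[x]reprK -[y]reprK -pi_quotZ -pi_quotD !gm0_tauE.
by rewrite linearP pi_quotD pi_quotZ.
Qed.
Fact gm0_dtau_linear : linear (gm0_dtau f g).
Proof.
move=> a x y; rewrite -[x]reprK -[y]reprK -pi_quotZ -pi_quotD !gm0_dtauE.
by rewrite linearP pi_quotD pi_quotZ.
Qed.
HB.instance Definition _ j := GRing.isLinear.Build K GM0 GM0 _ (gm0_tau f g j)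
  (gm0_tau_linear j).
HB.instance Definition _ := GRing.isLinear.Build K GM0 GM0 _ (gm0_dtau f g)
  gm0_dtau_linear.

Definition gm0_pi x : GM0 := \pi_GM0 (\pi_GM x).

Fact gm0_pi_linear : linear gm0_pi.
Proof. by move=> a x y; rewrite /gm0_pi !pi_quotD !pi_quotZ. Qed.
HB.instance Definition _ := GRing.isLinear.Build K L GM0 _ gm0_pi gm0_pi_linear.

Lemma gm0_piP (z : GM0) : exists x, z = gm0_pi x.
Proof. by exists (repr (repr z)); rewrite /gm0_pi !reprK. Qed.

Lemma gm0_tau_pi j x : gm0_tau f g j (gm0_pi x) = gm0_pi (ltau j x).
Proof. by rewrite /gm0_pi gm0_tauE gm_tauE. Qed.

Lemma gm0_dtau_pi x : gm0_dtau f g (gm0_pi x) = gm0_pi (ldtau f x).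
Proof. by rewrite /gm0_pi gm0_dtauE gm_dtauE. Qed.

Lemma gm0_pi_d x : gm0_pi (twisted_d f g x) = 0.
Proof.
rewrite -(linear0 gm0_pi); congr (\pi_GM0 _); apply/pi_quotP.
by rewrite subr0; exists x.
Qed.

Lemma gm0_pi_t i x : gm0_pi (lmul (g i) x) = 0.
Proof.
rewrite -(linear0 gm0_pi); apply/pi_quotP; rewrite -pi_quotB subr0 -gm_tE.
exists (fun l => if l == i then \pi_GM x else 0).
rewrite (bigD1 i) //= eqxx big1 ?addr0 // => l /negPf ->; exact: linear0.
Qed.

Lemma gm0_pi_eq0 x : gm0_pi x = 0 ->
  exists y (z : 'I_n -> L), x = twisted_d f g y + \sum_i lmul (g i) (z i).
Proof.
rewrite -(linear0 gm0_pi) => /pi_quotP; rewrite -pi_quotB subr0 => -[z xz].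
have /pi_quotP[y _ yE] : \pi_GM x = \pi_GM (\sum_i lmul (g i) (repr (z i))).
  rewrite xz; have piD : {morph (fun x => \pi_GM x : GM) : x y / x + y}.
    exact: pi_quotD.
  have pi0 : \pi_GM 0 = 0 :> GM by rewrite -[0 in LHS](subrr 0) pi_quotB subrr.
  rewrite (big_morph _ piD pi0); apply: eq_bigr => i _.
  by rewrite -gm_tE reprK.
exists y, (fun i => repr (z i)); by rewrite yE subrK.
Qed.

Definition lcoef_at k x : O := lcoef x k.
Fact lcoef_at_linear k : linear (lcoef_at k).
Proof. by move=> a x y; rewrite /lcoef_at lcoefD lcoefZ. Qed.
HB.instance Definition _ k := GRing.isLinear.Build K L O _ (lcoef_at k)
  (lcoef_at_linear k).

Lemma lcoef_twisted_d x k :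
  lcoef (twisted_d f g x) k = jac g (lcoef x k) - lcoef x (k - 1) * J.
Proof.
have D_lin : linear (fun x => jac g (lcoef x k) - lcoef x (k - 1) * J).
  move=> a y z; rewrite !lcoefD !lcoefZ linearP mulrDl -scalerAl.
  by rewrite scalerBr opprD addrACA.
pose D : {linear L -> O} := HB.pack (fun x => jac g (lcoef x k) - lcoef x (k - 1) * J)
  (GRing.isLinear.Build K L O _ _ D_lin).
rewrite -[RHS]/(D x) [x]lmonoE [twisted_d _ _ _]linear_sum [D _]linear_sum.
rewrite [LHS](linear_sum (lcoef_at k)); apply: eq_bigr => l _; rewrite /lcoef_at /=.
rewrite twisted_d_lmono [LHS]linearB /= /lcoef_at !lcoef_lmono.
rewrite [jac g (_ *+ _)]raddfMn mulrnAl; congr (_ - _ *+ nat_of_bool _).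
by rewrite -(inj_eq (addIr (-1))) addrK.
Qed.

Lemma lcoef_lmul q x k : lcoef (lmul q x) k = q * lcoef x k.
Proof.
rewrite {1}[x]lmonoE [lmul _ _]linear_sum [LHS](linear_sum (lcoef_at k)).
rewrite [in RHS](lmonoE x) [lcoef (\sum_(_ <- _) _) _](linear_sum (lcoef_at k)).
rewrite mulr_sumr.
by apply: eq_bigr => l _; rewrite /= lmul_lmono /lcoef_at !lcoef_lmono mulrnAr.
Qed.

(** The class of [q alpha tau^m]. *)
Definition gm0_mono m q : GM0 := gm0_pi (lmono m q).
Fact gm0_mono_linear m : linear (gm0_mono m).
Proof. by move=> a x y; rewrite /gm0_mono !linearP. Qed.
HB.instance Definition _ m := GRing.isLinear.Build K O GM0 _ (gm0_mono m)
  (gm0_mono_linear m).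

Lemma gm0_mono0 m : gm0_mono m 0 = 0.
Proof. exact: (linear0 (gm0_mono m)). Qed.
Lemma gm0_monoD m q a : gm0_mono m (q + a) = gm0_mono m q + gm0_mono m a.
Proof. exact: (linearD (gm0_mono m)). Qed.
Lemma gm0_monoN m q : gm0_mono m (- q) = - gm0_mono m q.
Proof. exact: (linearN (gm0_mono m)). Qed.
Lemma gm0_monoZ m (c : K) q : gm0_mono m (c *: q) = c *: gm0_mono m q.
Proof. exact: (linearZZ (gm0_mono m)). Qed.
Lemma gm0_tauD j (u v : GM0) :
  gm0_tau f g j (u + v) = gm0_tau f g j u + gm0_tau f g j v.
Proof. exact: (linearD (gm0_tau f g j)). Qed.
Lemma gm0_tauZ j (c : K) (u : GM0) : gm0_tau f g j (c *: u) = c *: gm0_tau f g j u.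
Proof. exact: (linearZZ (gm0_tau f g j)). Qed.
Lemma gm0_dtauD (u v : GM0) : gm0_dtau f g (u + v) = gm0_dtau f g u + gm0_dtau f g v.
Proof. exact: (linearD (gm0_dtau f g)). Qed.
Lemma gm0_dtauZ (c : K) (u : GM0) : gm0_dtau f g (c *: u) = c *: gm0_dtau f g u.
Proof. exact: (linearZZ (gm0_dtau f g)). Qed.

Lemma gm0_tau_mono j m q : gm0_tau f g j (gm0_mono m q) = gm0_mono (m + j) q.
Proof. by rewrite /gm0_mono gm0_tau_pi ltau_lmono. Qed.

Lemma gm0_mono_ideal m q : I q -> gm0_mono m q = 0.
Proof.
move=> [c ->]; rewrite linear_sum big1 // => i _.
by rewrite /= mulrC /gm0_mono -lmul_lmono gm0_pi_t.
Qed.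

Lemma gm0_mono_jac m q : gm0_mono m (jac g q) = gm0_mono (m + 1) (q * J).
Proof.
have := gm0_pi_d (lmono m q).
by rewrite twisted_d_lmono linearB /= => /eqP; rewrite subr_eq0 => /eqP.
Qed.

Lemma gm0_tau_dtau_mono m q : gm0_tau f g 1 (gm0_dtau f g (gm0_mono m q)) =
  m%:~R *: gm0_mono m q + gm0_mono (m + 1) (- f * q).
Proof.
rewrite /gm0_mono gm0_dtau_pi gm0_tau_pi ldtau_lmono linearB /= !ltau_lmono.
rewrite subrK linearB /= mulNr [lmono _ (- _)]linearN linearN /=; congr (_ - _).
by rewrite -scaler_int !linearZ.
Qed.

Lemma gm0_tauK j : cancel (gm0_tau f g j) (gm0_tau f g (- j)).
Proof.
move=> z; have [x ->] := gm0_piP z; rewrite !gm0_tau_pi; congr gm0_pi.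
apply: (laurent_ind (phi := ltau (- j) \o ltau j) (psi := idfun)) => k q /=.
by rewrite !ltau_lmono addrK.
Qed.

Lemma gm0_mono_gen (S : set GM0) (P : int -> Prop) x : subspace S ->
  (forall k, lcoef x k != 0 -> P k) -> (forall k q, P k -> S (gm0_mono k q)) ->
  S (gm0_pi x).
Proof.
move=> S_sub xP SP; rewrite [x]lmonoE linear_sum; apply: subspace_sum => // k xk.
by apply/SP/xP; rewrite /lcoef monalg.mcoeff_neq0.
Qed.

Lemma lattice0_subspace : subspace (lattice0 f g).
Proof.
split.
  exists (\pi_GM 0); last exact: linear0 gm0_pi.
  by exists 0 => // k _; apply: monalg.mcoeff0.
move=> a _ _ [_ [x x0 ->] <-] [_ [y y0 ->] <-].
exists (\pi_GM (a *: x + y)); last exact: linearP gm0_pi a x y.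
by exists (a *: x + y) => // k k0; rewrite lcoefD lcoefZ x0 // y0 // scaler0 addr0.
Qed.

Lemma lattice0P z : lattice0 f g z <->
  exists2 x, (forall k, 0 < k -> lcoef x k = 0) & z = gm0_pi x.
Proof.
split=> [[_ [x x0 ->] <-]|[x x0 ->]]; first by exists x.
by exists (\pi_GM x) => //; exists x.
Qed.

Lemma jac_ideal q : I q -> I (jac g q).
Proof.
move=> [c ->]; rewrite linear_sum.
apply: subspace_sum (base_ideal_is_ideal g).1 _ => i _ /=.
rewrite jacM jac_base mulr0 add0r mulrC.
by apply: (base_ideal_is_ideal g).2; apply: base_ideal_mem.
Qed.

End GaussManin0.

(** * The basis given by the modified Jordan basis *)

Fact shift_omega_tilde_identity (K : comRingType) (V : lmodType K) (x y z : V) (v w : K) :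
  w *: x + y + (v - 1) *: ((w - 1) *: z + x) + (1 - w) *: (x + (v - 1) *: z) =
  y + v *: x.
Proof.
have -> : v *: x = w *: x + (v - 1) *: x + (1 - w) *: x.
  by rewrite -!scalerDl; congr (_ *: x); ring.
have -> : (v - 1) *: ((w - 1) *: z + x) = (v - 1) *: x - (1 - w) *: ((v - 1) *: z).
  by rewrite scalerDr !scalerA [LHS]addrC -scaleNr; congr (_ + _ *: z); ring.
rewrite scalerDr [w *: x + y]addrC -!addrA; congr (y + (_ + (_ + _))).
by rewrite addrCA addNr addr0.
Qed.

Section OmegaTilde.
Variables (K : numFieldType) (n : nat) (p : 'I_n.+1 -> rat).
Local Notation O := {mpoly K[n.+1]}.
Hypothesis p_gt0 : forall i, 0 < p i.
Variables (g : 'I_n -> O) (e : 'I_n -> rat) (f : O).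
Hypothesis g_homog : forall i, whomog p (e i) (g i).
Hypothesis f_homog : whomog p 1 f.
Local Notation I := (base_ideal g).
Local Notation J := (jac g f).
Local Notation A := (ideal_add J I).
Hypothesis f_nzd : forall q, I (f * q) -> I q.
Variables (mu2 : nat) (h : 'I_mu2 -> O) (N : 'I_mu2 -> nat).
Hypothesis h_Jordan : Jordan_basis p f g h N.
Local Notation idx := {i : 'I_mu2 & 'I_(N i).+1}.
Local Notation L := (laurent K n).
Local Notation GM0 := (GaussManin0 f g).
Local Notation om i j := (omega f (h i) j).
Local Notation om_ k := (om (tag k) (tagged k)).
Local Notation jidx j := (Tagged (fun i => 'I_(N i).+1) j).
Local Notation mono := (gm0_mono f g).
Implicit Types (q : O) (k : idx) (m : int).

Let I_ideal := base_ideal_is_ideal g.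

Let nu_ k : rat := nu p e (om_ k).
Let lam k : rat := lambda (nu_ k).

(** The correction in degree [-1] that turns [omega] into [omega_tilde]. *)
Definition omega_tail k : O :=
  if 1 < nu_ k then ratr (nu_ k - 1) *: om (tag k) (tagged k).-1 else 0.

Definition tau_omega_tilde (t : idx * int) : GM0 :=
  mono t.2 (om_ t.1) + mono (t.2 - 1) (omega_tail t.1).

Lemma tau_omega_tilde0 k :
  tau_omega_tilde (k, 0) = omega_tilde p e f g (h (tag k)) (tagged k).
Proof.
rewrite /tau_omega_tilde /omega_tail /omega_tilde -/(nu_ k) /=; case: ifP => _.
  by rewrite gm0_monoZ -[gm0_class f g (om _ _.-1)]/(mono 0 _) gm0_tau_mono.
by rewrite gm0_mono0 addr0.
Qed.

Lemma tau_tau_omega_tilde k m j :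
  gm0_tau f g j (tau_omega_tilde (k, m)) = tau_omega_tilde (k, m + j).
Proof. by rewrite /tau_omega_tilde gm0_tauD !gm0_tau_mono addrAC. Qed.

Lemma lam01 k : 0 <= lam k <= 1.
Proof.
rewrite /lam /lambda; case: ltP => [_|nu1]; first by rewrite ler01 lexx.
by case: (leP 0 (nu_ k)) => [nu0|_]; rewrite ?nu0 ?nu1 ?lexx ?ler01.
Qed.

Definition succ_idx k : option idx :=
  omap (fun j : 'I_(N (tag k)).+1 => jidx j) (insub (tagged k).+1).

Definition rk_idx k : nat := N (tag k) - tagged k.

Lemma succ_idx_rk k k' : succ_idx k = Some k' -> (rk_idx k' < rk_idx k)%N.
Proof.
case: k => i j; rewrite /succ_idx /=; case: insubP => //= j' jN j'E [<-].
by rewrite /rk_idx /= j'E; lia.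
Qed.

(** Let [s] be the operator [tau dtau]. As [s omega^j = tau omega^(j+1)] and
    [dtau s = (s + 1) dtau], the correction terms are made for
    [(s + lambda) omega_tilde^j = tau omega_tilde^(j+1)]. At the end of a chain
    [(s + nu) omega^N = 0], because [f omega^N = u df] gives
    [s omega^N = - tau u df = - du = - nu omega^N]; and [0 <= nu] there, so that
    [lambda] is the expected eigenvalue. *)
Lemma shift_omega_tilde k m :
  shift (gm0_tau f g 1 \o gm0_dtau f g) (lam k - m%:~R) (tau_omega_tilde (k, m)) =
  oapp (fun k' => tau_omega_tilde (k', m + 1)) 0 (succ_idx k).
Proof.
case: k => i j; pose nuj := nu p e (om i j).
have nujE : nuj = nu p e (h i) + j%:R by apply: (nu_omega e f_homog h_Jordan).
have sE m' j' : gm0_tau f g 1 (gm0_dtau f g (mono m' (om i j'))) =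
    m'%:~R *: mono m' (om i j') + mono (m' + 1) (om i j'.+1).
  by rewrite gm0_tau_dtau_mono -omegaS.
pose x := mono m (om i j); pose y := mono (m + 1) (om i j.+1).
pose z := mono (m - 1) (om i j.-1).
have -> : shift (gm0_tau f g 1 \o gm0_dtau f g) (lam (jidx j) - m%:~R)
    (tau_omega_tilde (jidx j, m)) =
   y + (if 1 < nuj then ratr nuj *: x else ratr (lambda nuj) *: x).
  rewrite /shift /lam /nu_ rmorphB /= ratr_int.
  rewrite /tau_omega_tilde /omega_tail /nu_ /= -/nuj /lambda.
  case: ifP => nu1; last first.
    rewrite gm0_mono0 addr0 sE -/x -/y scalerBl.
    move: (m%:~R *: x) (ratr _ *: x) => u w.
    by rewrite addrC addrA subrK addrC.
  have j0 : (0 < j)%N.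
    rewrite lt0n; apply: contraTneq nu1 => j0; rewrite nujE j0 addr0 -leNgt.
    exact (nu_h_le1 p_gt0 g_homog f_homog h_Jordan i).
  rewrite gm0_monoZ gm0_dtauD gm0_tauD gm0_dtauZ gm0_tauZ !sE subrK prednK //.
  rewrite -/x -/y -/z rmorph1 rmorphB rmorph1 /= intrB.
  move: (ratr nuj) (m%:~R : K) => v w.
  exact: shift_omega_tilde_identity.
rewrite /succ_idx /=; case: insubP => [j' jN j'E|] /=.
  rewrite /tau_omega_tilde /omega_tail /nu_ /= j'E /= addrK; congr (_ + _).
  have -> : nu p e (om i j.+1) = nuj + 1.
    by rewrite -j'E (nu_omega e f_homog h_Jordan) j'E nujE -addn1 natrD addrA.
  have -> : (1 < nuj + 1) = (0 < nuj) by rewrite -subr_gt0 addrK.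
  rewrite [nuj + 1 - 1]addrK -/x /lambda.
  case: (ltP 1 nuj) => [nu1|nu1]; first by rewrite (lt_trans ltr01 nu1) gm0_monoZ.
  by case: (ltgtP 0 nuj) => [nu0|nu0|<-];
    rewrite ?gm0_monoZ ?rmorph0 ?scale0r ?gm0_mono0.
rewrite ltnS -leqNgt => jN.
have jNE : (j : nat) = N i by apply/eqP; rewrite eqn_leq jN -ltnS ltn_ord.
have [u [uP Ju nu0]] := omega_last p_gt0 g_homog f_homog f_nzd h_Jordan i.
rewrite -jNE in uP Ju nu0.
have -> : y = - (ratr nuj *: x).
  rewrite /y omegaS mulNr gm0_monoN; congr (- _).
  rewrite -[f * _](subrK (u * J)) gm0_monoD gm0_mono_ideal // add0r -gm0_mono_jac.
  rewrite -[jac g u](subrK (ratr nuj *: om i j)) gm0_monoD gm0_mono_ideal //.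
  by rewrite add0r gm0_monoZ.
rewrite /lambda -/nuj in nu0 *; rewrite nu0.
by case: (1 < nuj) => /=; move: (ratr nuj *: x) => w; rewrite addNr.
Qed.

Lemma omega_free (a : idx -> K) : A (\sum_k a k *: om_ k) -> forall k, a k = 0.
Proof. by have [_ _] := Jordan_basis_of h_Jordan; apply. Qed.

(** Lift a relation and compare the coefficients of the powers of [tau] from the
    top: as soon as the higher coefficients vanish modulo [g], what remains is
    [sum c omega = - u df], which forces [c = 0], and [u = 0] on the curve since
    [J] is not a zero divisor there. *)
Lemma omega_tilde_free : free_family tau_omega_tilde.
Proof.
apply: free_familyP => s c us sc0.
pose bl (t : idx * int) : L := lmono t.2 (om_ t.1) + lmono (t.2 - 1) (omega_tail t.1).
have [y [z xyz]] : exists y (z : 'I_n -> L),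
    \sum_(t <- s) c t *: bl t = twisted_d f g y + \sum_i lmul (g i) (z i).
  apply: gm0_pi_eq0; rewrite linear_sum -[RHS]sc0; apply: eq_bigr => t _.
  by rewrite linearZ /= linearD.
pose d k m := if (k, m) \in s then c (k, m) else 0.
have coefE m : I (\sum_k d k m *: om_ k + \sum_k d k (m + 1) *: omega_tail k
    - (jac g (lcoef y m) - lcoef y (m - 1) * J)).
  have sumE m' (F : idx -> O) :
      \sum_(t <- s) c t *: (F t.1 *+ (t.2 == m')) = \sum_k d k m' *: F k.
    rewrite (partition_big (fun t => t.1) xpredT) //=; apply: eq_bigr => k _.
    have H0 t : t != (k, m') -> t.1 == k -> c t *: (F t.1 *+ (t.2 == m')) = 0.
      case: t => k' m'' /= tk /eqP kk; case: eqP => [mm|_]; last by rewrite scaler0.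
      by case/eqP: tk; rewrite kk mm.
    rewrite /d; case: ifP => [ks|ks].
      rewrite big_mkcond (bigD1_seq (k, m')) //= !eqxx big1 ?addr0 // => t tk.
      by case: ifP => // /(H0 _ tk).
    rewrite scale0r big_seq_cond big1 // => t /andP[ts tk]; apply: H0 => //.
    by apply: contraFneq ks => <-.
  have xyzm : lcoef_at m (\sum_(t <- s) c t *: bl t) =
      (jac g (lcoef y m) - lcoef y (m - 1) * J) + \sum_i g i * lcoef (z i) m.
    rewrite xyz /lcoef_at lcoefD lcoef_twisted_d; congr (_ + _).
    rewrite -[lcoef _ _]/(lcoef_at m _) (linear_sum (lcoef_at m)).
    by apply: eq_bigr => i _; apply: lcoef_lmul.
  rewrite -(sumE m (fun k => om_ k)) -(sumE (m + 1) omega_tail) -big_split /=.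
  rewrite (eq_bigr (fun t => lcoef_at m (c t *: bl t))); last first.
    move=> t _; rewrite /lcoef_at lcoefZ lcoefD !lcoef_lmono scalerDr.
    by rewrite subr_eq.
  have -> : \sum_(t <- s) lcoef_at m (c t *: bl t) =
      lcoef_at m (\sum_(t <- s) c t *: bl t).
    exact: esym (linear_sum (lcoef_at m) _ _ _).
  rewrite xyzm addrAC subrr add0r.
  apply: subspace_sum I_ideal.1 _ => i _; rewrite mulrC.
  by apply: I_ideal.2; apply: base_ideal_mem.
have [My MyP] := lcoef_bounded y.
pose M : int := \sum_(t <- s) `|t.2| + `|My| + 1.
have top m : M <= m -> (forall k, d k m = 0) /\ I (lcoef y (m - 1)).
  have s0 : 0 <= \sum_(t <- s) `|t.2| by apply: sumr_ge0.
  rewrite /M => Mm; split=> [k|].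
    rewrite /d; case: ifP => // ks.
    have mS : m <= \sum_(t <- s) `|t.2|.
      by rewrite (big_rem (k, m)) //= (le_trans (ler_norm m)) // lerDl sumr_ge0.
    by move: (\sum_(t <- s) _) Mm mS s0 => S; lia.
  have [->|/MyP] := eqVneq (lcoef y (m - 1)) 0; first exact: I_ideal.1.1.
  by move: (\sum_(t <- s) _) Mm s0 => S; lia.
have step m : (forall k, d k (m + 1) = 0) /\ I (lcoef y m) ->
    (forall k, d k m = 0) /\ I (lcoef y (m - 1)).
  move=> [dm ym]; have := coefE m.
  rewrite [X in _ + X - _]big1 => [|k _]; last by rewrite dm scale0r.
  rewrite addr0 opprB addrA => Im.
  have {}Im : I (\sum_k d k m *: om_ k + lcoef y (m - 1) * J).
    rewrite -[X in I X](subrK (jac g (lcoef y m))).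
    by apply: subspaceD I_ideal.1 Im _; apply: jac_ideal.
  have dm0 : forall k, d k m = 0.
    apply: (@omega_free (fun k => d k m)); exists (- lcoef y (m - 1)).
    by rewrite mulNr opprK.
  split=> //; apply: (jac_nzd f_nzd h_Jordan).
  by move: Im; rewrite big1 ?add0r // => k _; rewrite dm0 scale0r.
have all i : (forall k, d k (M - i%:Z) = 0) /\ I (lcoef y (M - i%:Z - 1)).
  elim: i => [|i IH]; first by apply: top; rewrite subr0.
  have e1 : M - i.+1%:Z + 1 = M - i%:Z by lia.
  have e2 : M - i%:Z - 1 = M - i.+1%:Z by lia.
  by apply: step; rewrite e1 -e2.
move=> [k m] ts; suff : d k m = 0 by rewrite /d ts.
have [Mm|mM] := leP M m; first exact: (top m Mm).1.
have [+ _] := all `|M - m|%N; have -> : M - `|M - m|%N%:Z = m by lia.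
by move=> ->.
Qed.

Lemma tau_span_on j (P Q : idx * int -> Prop) x :
  (forall t, P t -> Q (t.1, t.2 + j)) -> span_on tau_omega_tilde P x ->
  span_on tau_omega_tilde Q (gm0_tau f g j x).
Proof.
move=> PQ; apply: (span_on_min (S := gm0_tau f g j @^-1` span_on tau_omega_tilde Q)) x.
  have [S0 SD] := span_on_subspace tau_omega_tilde Q.
  split=> [|a x y Sx Sy] /=; rewrite /preimage /=.
    by rewrite [gm0_tau _ _ _ _]linear0.
  by rewrite gm0_tauD gm0_tauZ; apply: SD.
move=> [k m] Pt; rewrite /preimage /= tau_tau_omega_tilde.
by apply: span_on_mem; apply: PQ Pt.
Qed.

(** By induction on a bound for the degrees in [q]: modulo [df] a form is a
    combination of the [omega], a multiple [u df] is traded for [tau^-1 du], and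
    [omega] differs from [omega_tilde] by a multiple of [tau^-1] times the
    preceding [omega]; both [du] and the preceding [omega] have degree one
    less. *)
Lemma mono_span q : span_on tau_omega_tilde (fun t => t.2 <= 0) (mono 0 q).
Proof.
have [S0 SD] := span_on_subspace tau_omega_tilde (fun t : idx * int => t.2 <= 0).
set S := span_on _ _ in S0 SD *.
have S_sub : subspace S by [].
have tauS a : S (mono 0 a) -> S (mono (-1) a).
  move=> Sa; have -> : mono (-1) a = gm0_tau f g (-1) (mono 0 a).
    by rewrite gm0_tau_mono add0r.
  by apply: tau_span_on Sa => t /= t0; lia.
have [r qr] : exists r : nat,
    forall m : 'X_{1..n.+1}, m \in msupp q -> weight p m < r%:R.
  exists (Num.bound (\sum_(m <- msupp q) weight p m)) => m mq.
  apply: le_lt_trans (archi_boundP _); last by apply: sumr_ge0 => *; apply: weight_ge0.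
  by rewrite (big_rem m) //= lerDl sumr_ge0 // => *; apply: weight_ge0.
elim: r q qr => [|r IH] q qr.
  suff -> : q = 0 by rewrite gm0_mono0.
  apply/eqP; rewrite -msupp_eq0; case: (msupp q) qr => // m s /(_ m (mem_head _ _)).
  by rewrite ltNge weight_ge0.
(* Truncation keeps the degrees of all terms under control. *)
pose F : O -> O := wfilter p (fun w => w < r.+1%:R).
have [_ span _] := Jordan_basis_of h_Jordan.
have [c [u cu]] := span q Logic.I.
have J_homog := jac_homog g_homog f_homog.
set dJ := 1 + _ - _ in J_homog.
pose u' := wfilter p (fun w => w + dJ < r.+1%:R) u.
have IF : I (q - \sum_k c k *: F (om_ k) - u' * J).
  have := base_ideal_wfilter (fun w => w < r.+1%:R) g_homog cu.
  rewrite !raddfB /= (wfilterM _ _ J_homog) -/u' (wfilter_id qr).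
  congr (I (_ - _ - _)); rewrite [wfilter _ _ _]linear_sum; apply: eq_bigr => k _.
  by rewrite [LHS]linearZ.
have -> : mono 0 q = mono 0 (\sum_k c k *: F (om_ k)) + mono (-1) (jac g u').
  have := gm0_mono_ideal f 0 IF.
  move=> /eqP; rewrite -addrA -opprD gm0_monoD gm0_monoN addr_eq0 opprK => /eqP ->.
  by rewrite gm0_monoD gm0_mono_jac.
apply: subspaceD S_sub _ _; last first.
  apply/tauS/IH => m /(jac_wlt g_homog) mu.
  have : weight p m < r.+1%:R - dJ + \sum_i e i - \sum_i p i.
    apply: mu => m'; rewrite mcoeff_msupp mcoeff_wfilter.
    case: ifP => [|_]; last by rewrite eqxx.
    by rewrite -ltrBrDr.
  by rewrite /dJ -addn1 natrD; lra.
have -> : mono 0 (\sum_k c k *: F (om_ k)) = \sum_k c k *: mono 0 (F (om_ k)).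
  rewrite (big_morph _ (gm0_monoD f g 0) (gm0_mono0 f g 0)).
  by apply: eq_bigr => k _; rewrite gm0_monoZ.
apply: subspace_sum => // -[i j] _ /=; apply: subspaceZ => //.
have om_homog := omega_homog f_homog h_Jordan.
rewrite /F (wfilter_whomog _ (@om_homog i j)).
case: ifP => [omr|_]; last by rewrite gm0_mono0.
have -> : mono 0 (om i j) = tau_omega_tilde (jidx j, 0) - mono (-1) (omega_tail (jidx j)).
  by rewrite /tau_omega_tilde /= sub0r addrK.
apply: subspaceB => //; first exact: span_on_mem.
rewrite /omega_tail; case: ifP => [nu1|_]; last by rewrite gm0_mono0.
rewrite gm0_monoZ; apply: subspaceZ => //; apply/tauS/IH => m.
have j0 : (0 < j)%N.
  rewrite lt0n; apply: contraTneq nu1 => j0.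
  rewrite /nu_ /= (nu_omega e f_homog h_Jordan) j0 addr0 -leNgt.
  exact (nu_h_le1 p_gt0 g_homog f_homog h_Jordan i).
move=> /om_homog ->; move: omr; rewrite /= -[in X in X -> _](prednK j0) -!natr1.
by lra.
Qed.

Lemma omega_tilde_span x : span_on tau_omega_tilde (fun=> True) x.
Proof.
have [y ->] := gm0_piP x.
apply: (@gm0_mono_gen _ _ _ _ _ (fun=> True)) => // [|k q _].
  exact: span_on_subspace.
have -> : gm0_mono f g k q = gm0_tau f g k (mono 0 q) by rewrite gm0_tau_mono add0r.
by apply: tau_span_on (mono_span q).
Qed.

Lemma lattice0_span : lattice0 f g = span_on tau_omega_tilde (fun t => t.2 <= 0).
Proof.
rewrite eqEsubset; split=> x.
  move=> /lattice0P[y y0 ->]; 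
  refine (@gm0_mono_gen K n f g _ (fun k : int => k <= 0) y _ _ _).
  - exact: span_on_subspace.
  - by move=> k; rewrite leNgt; apply: contraNN => /y0 ->.
  move=> k q k0; have -> : gm0_mono f g k q = gm0_tau f g k (mono 0 q).
    by rewrite gm0_tau_mono add0r.
  by apply: tau_span_on (mono_span q) => t /= t0; lia.
move: x; apply: span_on_min => [|[k m] /= m0]; first exact: lattice0_subspace.
apply/lattice0P; exists (lmono m (om_ k) + lmono (m - 1) (omega_tail k)).
  move=> l l0; rewrite lcoefD !lcoef_lmono.
  have -> : (m == l) = false by lia.
  have -> : (m - 1 == l) = false by lia.
  exact: addr0.
by rewrite /tau_omega_tilde /gm0_mono [RHS](linearD (gm0_pi f g)).
Qed.

Lemma tau_lattice0_span :
  gm0_tau f g (-1) @` lattice0 f g = span_on tau_omega_tilde (fun t => t.2 <= -1).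
Proof.
rewrite lattice0_span eqEsubset; split=> x.
  by move=> [y yS <-]; apply: tau_span_on yS => t /= t0; lia.
move=> xS; exists (gm0_tau f g 1 x); last exact: gm0_tauK.
by apply: tau_span_on xS => t /= t0; lia.
Qed.

End OmegaTilde.

Theorem theorem4p7 (R : realType) (n : nat) (p : 'I_n.+1 -> rat)
    (g : 'I_n -> {mpoly R[i][n.+1]}) (e : 'I_n -> rat)
    (f : {mpoly R[i][n.+1]})
    (p_gt0 : forall i, 0 < p i)
    (g_homog : forall i, whomog p (e i) (g i))
    (C0_reduced : radical_ideal (base_ideal g))
    (C0_curve : krull_dim (base_ideal g) 1)
    (C0_not_smooth : ~ smooth_fiber g)
    (f_homog : whomog p 1 f)
    (f_nonconstant : nonconstant_on_branches f g)
    (V : rat -> set (GaussManin0 f g))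
    (V_MK : MK_filtration (gm0_tau f g 1) (gm0_dtau f g) V)
    (mu2 : nat) (h : 'I_mu2 -> {mpoly R[i][n.+1]}) (N : 'I_mu2 -> nat)
    (h_Jordan : Jordan_basis p f g h N) :
  let G0 := lattice0 f g in
  let tauV := gm0_tau f g (-1) in
  let idx := {i : 'I_mu2 & 'I_(N i).+1} in
  let lam (ij : idx) := lambda (nu p e (omega f (h (tag ij)) (tagged ij))) in
  [/\ forall l : rat, (exists ij, lam ij = l) ->
        subquot_basis (gr_num V G0 l) (gr_den tauV V G0 l)
          (fun k : {ij : idx | lam ij == l} =>
             omega_tilde p e f g (h (tag (val k))) (tagged (val k))),
      forall l : rat,
        subquot_dim (gr_num V G0 l) (gr_den tauV V G0 l)
          #|[pred ij : idx | lam ij == l]|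
    & spectrum tauV V G0 =
        [set ld | (exists ij, lam ij = ld.1) /\
                  ld.2 = #|[pred ij : idx | lam ij == ld.1]|]].
Proof.
move=> G0 tauV idx lam.
have f_nzd q : base_ideal g (f * q) -> base_ideal g q.
  exact: nonconstant_nonzerodivisor C0_reduced f_nonconstant.
have b_free := omega_tilde_free (e := e) f_nzd h_Jordan.
have b_span := omega_tilde_span p_gt0 g_homog f_homog h_Jordan.
have lam_01 := @lam01 _ _ p e f _ h N.
have b_shift := shift_omega_tilde p_gt0 g_homog f_homog f_nzd h_Jordan.
have G_span := lattice0_span p_gt0 g_homog f_homog h_Jordan.
have tauG_span := tau_lattice0_span p_gt0 g_homog f_homog h_Jordan.
have sE : gm0_tau f g 1 \o gm0_dtau f g =1 gm0_tau f g 1 \o gm0_dtau f g by [].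
have rk := @succ_idx_rk mu2 N.
split.
- move=> l _; have := adapted_subquot_basis b_free b_span lam_01 rk b_shift V_MK sE
    G_span tauG_span l.
  by congr (subquot_basis _ _ _); apply: funext => k; apply: tau_omega_tilde0.
- move=> l; exact (adapted_subquot_dim b_free b_span lam_01 rk b_shift V_MK sE G_span
    tauG_span l).
- exact (adapted_spectrum b_free b_span lam_01 rk b_shift V_MK sE G_span tauG_span).
Qed.
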